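(* For every extreme point $C$ of $\mathrm{Cor}(n,m)$, the behavior $\mathbf{p}_C$ is a Gram-Lorentz behavior and $$\mathcal{D}(\mathbf{p}_C)\ge\sqrt{2}^{\,\lfloor\mathrm{rank}(C)/2\rfloor}.$$
   Context: $\mathrm{Cor}(n,m)$ is the (convex) set of matrices $C=(c_{xy})\in[-1,1]^{n\times m}$ for which there exist $d\ge1$, Hermitian $d\times d$ matrices $M_1,\dots,M_n,N_1,\dots,N_m$ with eigenvalues in $[-1,1]$ and a Hermitian psd trace-one matrix $\rho$ on $\mathbb{C}^d\otimes\mathbb{C}^d$ with $c_{xy}=\mathrm{Tr}((M_x\otimes N_y)\rho)$ for all $x,y$. For $C\in\mathrm{Cor}(n,m)$, $\mathbf{p}_C$ is the behavior in the $(n,m,2,2)$-scenario with outcomes $a,b\in\{\pm1\}$ given by $p_C(ab|xy)=\frac{1+ab\,c_{xy}}{4}$. A quantum behavior $\mathbf{p}$ has a $d$-dimensional representation if there exist a Hermitian psd trace-one $\rho$ on $\mathbb{C}^d\otimes\mathbb{C}^d$ and, for each $x$, psd $d\times d$ matrices $\{M_{a|x}\}_a$ summing to $I_d$ and, for each $y$, psd $d\times d$ matrices $\{N_{b|y}\}_b$ summing to $I_d$, with $p(ab|xy)=\mathrm{Tr}((M_{a|x}\otimes N_{b|y})\rho)$; $\mathcal{D}(\mathbf{p})$ is the least such $d$. For a behavior $\mathbf{p}$ in an $(m_A,m_B,o_A,o_B)$-scenario let $N:=m_Ao_A+m_Bo_B$ and $\mathcal{A}(\mathbf{p})$ the set of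 real symmetric $N\times N$ matrices $R$ indexed by $([m_A]\times[o_A])\cup([m_B]\times[o_B])$ with $\sum_{a,a'}R_{xa,x'a'}=1$, $\sum_{a,b}R_{xa,yb}=1$, $\sum_{b,b'}R_{yb,y'b'}=1$ for all $x,x',y,y'$, and $R_{xa,yb}=p(ab|xy)$. A matrix is Gram-Lorentz if it is the Gram matrix of vectors in some Lorentz cone $\mathcal{L}_k:=\{(c,x)\in\mathbb{R}\times\mathbb{R}^{k-1}:c\ge\|x\|\}$; a quantum behavior $\mathbf{p}$ is Gram-Lorentz if some Gram-Lorentz matrix lies in $\mathcal{A}(\mathbf{p})$. *)

(* Defs.v *)
From HB Require Import structures.
From mathcomp Require Import all_boot all_order all_algebra.
From mathcomp Require Import complex mxtens.
From mathcomp Require Import reals.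
Set Implicit Arguments. Unset Strict Implicit. Unset Printing Implicit Defensive.
Import Order.TTheory GRing.Theory Num.Theory.
Local Open Scope ring_scope.

Section Defs.
Variable R : realType.
Local Notation C := R[i].

Definition adjmx (p q : nat) (A : 'M[C]_(p, q)) : 'M[C]_(q, p) :=
  \matrix_(i, j) (A j i)^*.

Definition hermitian (d : nat) (A : 'M[C]_d) : Prop := adjmx A = A.

(* positive semidefinite: Hermitian with nonnegative quadratic form
   (the order on R[i] : 0 <= z means z real and nonnegative) *)
Definition psd (d : nat) (A : 'M[C]_d) : Prop :=
  hermitian A /\ forall v : 'cV[C]_d, 0 <= (adjmx v *m A *m v) 0 0.

Definition eigs_in_pm1 (d : nat) (A : 'M[C]_d) : Prop :=
  forall a : C, eigenvalue A a -> (-1 <= a <= 1).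

(* Hermitian psd trace-one matrix on C^d (x) C^d *)
Definition density (d : nat) (rho : 'M[C]_(d * d)) : Prop :=
  psd rho /\ \tr rho = 1.

Definition inCor (n m : nat) (Cm : 'M[R]_(n, m)) : Prop :=
  (forall x y, -1 <= Cm x y <= 1) /\
  exists d : nat, (0 < d)%N /\
  exists (M : 'I_n -> 'M[C]_d) (N : 'I_m -> 'M[C]_d) (rho : 'M[C]_(d * d)),
    (forall x, hermitian (M x) /\ eigs_in_pm1 (M x)) /\
    (forall y, hermitian (N y) /\ eigs_in_pm1 (N y)) /\
    density rho /\
    forall x y, ((Cm x y)%:C)%C = \tr ((M x *t N y) *m rho).

Definition extreme_Cor (n m : nat) (Cm : 'M[R]_(n, m)) : Prop :=
  inCor Cm /\
  forall (C1 C2 : 'M[R]_(n, m)) (t : R), inCor C1 -> inCor C2 ->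
    0 < t < 1 -> Cm = t *: C1 + (1 - t) *: C2 -> C1 = Cm /\ C2 = Cm.

(* behaviors in the (mA,mB,oA,oB)-scenario: p a b x y = p(ab|xy) *)
Definition behavior (mA mB oA oB : nat) :=
  'I_oA -> 'I_oB -> 'I_mA -> 'I_mB -> R.

(* outcome 0 of 'I_2 stands for +1, outcome 1 for -1 *)
Definition sgn2 (a : 'I_2) : R := if a == ord0 then 1 else -1.

Definition pC (n m : nat) (Cm : 'M[R]_(n, m)) : behavior n m 2 2 :=
  fun a b x y => (1 + sgn2 a * sgn2 b * Cm x y) / 4.

Definition has_rep (mA mB oA oB : nat) (p : behavior mA mB oA oB) (d : nat)
  : Prop :=
  exists (rho : 'M[C]_(d * d)) (MA : 'I_mA -> 'I_oA -> 'M[C]_d)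
         (NB : 'I_mB -> 'I_oB -> 'M[C]_d),
    density rho /\
    (forall x a, psd (MA x a)) /\ (forall x, \sum_a MA x a = 1%:M) /\
    (forall y b, psd (NB y b)) /\ (forall y, \sum_b NB y b = 1%:M) /\
    forall a b x y, ((p a b x y)%:C)%C = \tr ((MA x a *t NB y b) *m rho).

Definition quantum (mA mB oA oB : nat) (p : behavior mA mB oA oB) : Prop :=
  exists d, has_rep p d.

Definition idx (mA mB oA oB : nat) : finType :=
  (('I_mA * 'I_oA) + ('I_mB * 'I_oB))%type.

Definition inA (mA mB oA oB : nat) (p : behavior mA mB oA oB)
  (Rm : idx mA mB oA oB -> idx mA mB oA oB -> R) : Prop :=
  (forall s t, Rm s t = Rm t s) /\
  (forall x x' : 'I_mA,
      \sum_(a < oA) \sum_(a' < oA) Rm (inl (x, a)) (inl (x', a')) = 1) /\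
  (forall (x : 'I_mA) (y : 'I_mB),
      \sum_(a < oA) \sum_(b < oB) Rm (inl (x, a)) (inr (y, b)) = 1) /\
  (forall y y' : 'I_mB,
      \sum_(b < oB) \sum_(b' < oB) Rm (inr (y, b)) (inr (y', b')) = 1) /\
  (forall x a y b, Rm (inl (x, a)) (inr (y, b)) = p a b x y).

Definition in_lorentz (k : nat) (v : 'rV[R]_k.+1) : Prop :=
  Num.sqrt (\sum_(i < k) v ord0 (lift ord0 i) ^+ 2) <= v ord0 ord0.

Definition gram_lorentz (T : finType) (Rm : T -> T -> R) : Prop :=
  exists (k : nat) (v : T -> 'rV[R]_k.+1),
    (forall s, in_lorentz (v s)) /\
    forall s t, Rm s t = \sum_(i < k.+1) v s ord0 i * v t ord0 i.

Definition gram_lorentz_behavior (mA mB oA oB : nat)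
  (p : behavior mA mB oA oB) : Prop :=
  quantum p /\ exists Rm, inA p Rm /\ gram_lorentz Rm.

End Defs.

(* Main.v *)
(* A correlation matrix [C] is the Gram block [<u_x, v_y>] of vectors of norm at
   most one: take [u_x = Q A_x] and [v_y = Q B_y] with [rho = Q^* Q], viewed as
   real vectors.  The vectors [(1, +-u_x) / 2] and [(1, +-v_y) / 2] then witness
   that [p_C] is Gram-Lorentz.
   Conversely, Clifford generators and the maximally entangled state turn every
   such Gram block into an element of Cor, so extremality of [C] can be tested on
   vectors: it forces unit norms, equal spans of the [u_x] and of the [v_y], and
   that the [u_x u_x^T] and [v_y v_y^T] span all symmetric forms on this span.
   The quadratic form [w |-> Q A(w)^2 - |w|^2 Q] vanishes at the [u_x] and [v_y],
   hence everywhere: an orthonormal basis of the span gives rank-many operators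
   satisfying the Clifford relations on [Q] times the commutant of the [A_x], a
   subspace of C^(d^2), so that [2 ^ (rank C / 2) <= d^2]. *)

Require Import Defs.
From HB Require Import structures.
From mathcomp Require Import all_boot all_order all_algebra.
From mathcomp Require Import complex mxtens.
From mathcomp Require Import reals.
From mathcomp Require Import ring lra zify.
Import Order.TTheory GRing.Theory Num.Theory.
Local Open Scope ring_scope.
Set Implicit Arguments. Unset Strict Implicit. Unset Printing Implicit Defensive.

(** * Adjoints, positive semidefinite matrices and the spectral theorem *)

Section Adjoint.
Variable R : realType.
Local Notation C := R[i].

Lemma adjmxE p q (A : 'M[C]_(p, q)) : adjmx A = map_mx Num.conj A^T.
Proof. by apply/matrixP=> i j; rewrite !mxE. Qed.

Lemma adjmxK p q (A : 'M[C]_(p, q)) : adjmx (adjmx A) = A.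
Proof. by apply/matrixP=> i j; rewrite !mxE conjCK. Qed.

Lemma adjmxM p q r (A : 'M[C]_(p, q)) (B : 'M[C]_(q, r)) :
  adjmx (A *m B) = adjmx B *m adjmx A.
Proof. by rewrite !adjmxE trmx_mul map_mxM. Qed.

Lemma adjmxD p q (A B : 'M[C]_(p, q)) : adjmx (A + B) = adjmx A + adjmx B.
Proof. by apply/matrixP=> i j; rewrite !mxE rmorphD. Qed.

Lemma adjmxN p q (A : 'M[C]_(p, q)) : adjmx (- A) = - adjmx A.
Proof. by apply/matrixP=> i j; rewrite !mxE rmorphN. Qed.

Lemma adjmxB p q (A B : 'M[C]_(p, q)) : adjmx (A - B) = adjmx A - adjmx B.
Proof. by rewrite adjmxD adjmxN. Qed.

Lemma adjmxZ p q a (A : 'M[C]_(p, q)) : adjmx (a *: A) = a^* *: adjmx A.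
Proof. by apply/matrixP=> i j; rewrite !mxE rmorphM. Qed.

Lemma adjmx1 d : adjmx (1%:M : 'M[C]_d) = 1%:M.
Proof. by rewrite adjmxE trmx1 map_mx1. Qed.

Lemma adjmx_tens p q r s (A : 'M[C]_(p, q)) (B : 'M[C]_(r, s)) :
  adjmx (A *t B) = adjmx A *t adjmx B.
Proof. by rewrite !adjmxE trmx_tens map_mxT. Qed.

Lemma psd_herm d (P : 'M[C]_d) : psd P -> adjmx P = P.
Proof. by case. Qed.

Lemma psd_adjM p d (Q : 'M[C]_(p, d)) : psd (adjmx Q *m Q).
Proof.
split=> [|v]; first by rewrite /Defs.hermitian adjmxM adjmxK.
rewrite mulmxA -adjmxM -mulmxA mxE sumr_ge0 // => i _.
by rewrite mxE mulrC mul_conjC_ge0.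
Qed.

Lemma psd_conj p d (J : 'M[C]_(d, p)) (P : 'M[C]_d) :
  psd P -> psd (adjmx J *m P *m J).
Proof.
case=> hP pP; split=> [|v]; first by rewrite /Defs.hermitian !adjmxM adjmxK hP mulmxA.
by have := pP (J *m v); rewrite adjmxM !mulmxA.
Qed.

Lemma psdD d (P Q : 'M[C]_d) : psd P -> psd Q -> psd (P + Q).
Proof.
move=> [hP pP] [hQ pQ]; split=> [|v]; first by rewrite /Defs.hermitian adjmxD hP hQ.
by rewrite mulmxDr mulmxDl mxE addr_ge0.
Qed.

Lemma psdZ d (a : C) (P : 'M[C]_d) : 0 <= a -> psd P -> psd (a *: P).
Proof.
move=> a0 [hP pP]; split=> [|v].
  by rewrite /Defs.hermitian adjmxZ hP conj_Creal // ger0_real.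
by rewrite -scalemxAr -scalemxAl mxE mulr_ge0.
Qed.

Lemma hermitian_diagonalization d (A : 'M[C]_d) : Defs.hermitian A ->
  exists (P : 'M[C]_d) (s : 'rV[C]_d),
    [/\ adjmx P *m P = 1%:M, P *m adjmx P = 1%:M & A = adjmx P *m diag_mx s *m P].
Proof.
move=> hA; have nA : A \is normalmx.
  by apply/normalmxP; rewrite -!map_trmx map_trmx -adjmxE hA.
have := orthomx_spectralP nA; set P := spectralmx A; set s := spectral_diag A.
have uP : P \is unitarymx by apply: spectral_unitarymx.
have PP : P *m adjmx P = 1%:M by rewrite adjmxE; apply/unitarymxP.
have PP' : adjmx P *m P = 1%:M by apply: mulmx1C.
rewrite invmx_unitary // -adjmxE => eA.
by exists P, s; split.
Qed.

(** [Q] is the diagonal matrix of square roots of the eigenvalues times the diagonalising unitary.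
    The eigenvalues are nonnegative because each is a value of the quadratic form. *)
Lemma psd_factor d (P : 'M[C]_d) :
  psd P -> exists Q : 'M[C]_d, P = adjmx Q *m Q.
Proof.
move=> [hP pP]; have [U [s [UU UU' eP]]] := hermitian_diagonalization hP.
have s0 i : 0 <= s 0 i.
  have := pP (adjmx U *m delta_mx i 0); rewrite adjmxM adjmxK eP.
  have -> : adjmx (delta_mx i 0 : 'cV[C]_d) = delta_mx 0 i.
    apply/matrixP=> a b; rewrite !mxE andbC.
    by case: (_ && _); rewrite ?conjC0 ?conjC1.
  rewrite -!mulmxA (mulmxA U (adjmx U)) UU' mul1mx (mulmxA U (adjmx U)) UU' mul1mx.
  by rewrite -rowE mul_diag_mx !mxE !eqxx mulr1.
exists (diag_mx (map_mx sqrtC s) *m U).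
rewrite adjmxM eP -!mulmxA; congr (_ *m _); rewrite !mulmxA; congr (_ *m _).
have -> : adjmx (diag_mx (map_mx sqrtC s)) = diag_mx (map_mx sqrtC s).
  apply/matrixP=> i j; rewrite !mxE eq_sym; case: eqP => [->|_].
    by rewrite !mulr1n conj_Creal // ger0_real // sqrtC_ge0.
  by rewrite !mulr0n conjC0.
by rewrite mulmx_diag; congr diag_mx; apply/rowP=> i; rewrite !mxE -expr2 sqrtCK.
Qed.

Lemma herm_psd_of_eig d (A : 'M[C]_d) : Defs.hermitian A ->
  (forall a, eigenvalue A a -> 0 <= a) -> psd A.
Proof.
move=> hA eA; have [U [s [UU UU' defA]]] := hermitian_diagonalization hA.
split=> // v; rewrite defA -!mulmxA mulmxA -{1}[U]adjmxK -adjmxM adjmxK.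
set w := U *m v; rewrite mxE sumr_ge0 // => i _.
rewrite mul_diag_mx !mxE mulrCA mulr_ge0 //; last by rewrite mulrC mul_conjC_ge0.
(* Row [i] of [U] is a left eigenvector for [s 0 i]; it is nonzero because the rows of [U] have norm
   one. *)
apply: eA; apply/eigenvalueP; exists (row i U).
  rewrite defA -row_mul !mulmxA UU' mul1mx row_mul row_diag_mx -scalemxAl -rowE //.
apply/eqP=> r0; have := congr1 (fun M : 'M_d => M i i) UU'.
rewrite !mxE eqxx mulr1n big1 => [/eqP|j _]; first by rewrite eq_sym oner_eq0.
by have := congr1 (fun v : 'rV_d => v 0 j) r0; rewrite !mxE => ->; rewrite mul0r.
Qed.

Lemma eigenvalue_opp d (A : 'M[C]_d) a : eigenvalue (- A) a -> eigenvalue A (- a).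
Proof.
case/eigenvalueP=> v; rewrite mulmxN => e v0; apply/eigenvalueP; exists v => //.
by rewrite scaleNr -e opprK.
Qed.

Lemma eigenvalue_add1 d (A : 'M[C]_d) a : eigenvalue (1%:M + A) a -> eigenvalue A (a - 1).
Proof.
case/eigenvalueP=> v; rewrite mulmxDr mulmx1 => e v0; apply/eigenvalueP; exists v => //.
by rewrite scalerBl scale1r -e addrC addKr.
Qed.

Lemma contraction_psd d (A : 'M[C]_d) : Defs.hermitian A -> eigs_in_pm1 A ->
  psd (1%:M + A) /\ psd (1%:M - A).
Proof.
move=> hA eA; have h1 := adjmx1 d; split; apply: herm_psd_of_eig.
- by rewrite /Defs.hermitian adjmxD hA h1.
- by move=> a /eigenvalue_add1 /eA /andP[]; rewrite lerBrDr addNr.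
- by rewrite /Defs.hermitian adjmxB hA h1.
- by move=> a /eigenvalue_add1/eigenvalue_opp /eA /andP[_]; rewrite opprB lerBlDr lerDl.
Qed.

End Adjoint.

(** * Bilinearity of the Kronecker product and expansions of traces *)

Section Tensor.
Variable K : comPzRingType.

Lemma tensmxDl m n p q (A B : 'M[K]_(m, n)) (D : 'M[K]_(p, q)) :
  (A + B) *t D = A *t D + B *t D.
Proof. by apply/matrixP=> i j; rewrite !mxE mulrDl. Qed.

Lemma tensmxDr m n p q (A B : 'M[K]_(m, n)) (D : 'M[K]_(p, q)) :
  D *t (A + B) = D *t A + D *t B.
Proof. by apply/matrixP=> i j; rewrite !mxE mulrDr. Qed.

Lemma tensmxZl m n p q c (A : 'M[K]_(m, n)) (D : 'M[K]_(p, q)) :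
  (c *: A) *t D = c *: (A *t D).
Proof. by apply/matrixP=> i j; rewrite !mxE mulrA. Qed.

Lemma tensmxZr m n p q c (A : 'M[K]_(m, n)) (D : 'M[K]_(p, q)) :
  D *t (c *: A) = c *: (D *t A).
Proof. by apply/matrixP=> i j; rewrite !mxE mulrCA. Qed.

Lemma tensmx11 m n : (1%:M : 'M[K]_m) *t (1%:M : 'M[K]_n) = 1%:M.
Proof.
apply/matrixP=> i j; case: (mxtens_indexP i) => i1 i2; case: (mxtens_indexP j) => j1 j2.
rewrite tensmxE !mxE (can_eq (@mxtens_indexK _ _)) xpair_eqE.
by case: eqP; case: eqP; rewrite ?mulr1 ?mulr0 ?mul0r.
Qed.

Lemma mxtrace_tens_affine d (M N : 'M[K]_d) (rho : 'M[K]_(d * d)) a b :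
  \tr (((1%:M + a *: M) *t (1%:M + b *: N)) *m rho) =
  \tr rho + a * \tr ((M *t 1%:M) *m rho) + b * \tr ((1%:M *t N) *m rho)
   + a * b * \tr ((M *t N) *m rho).
Proof.
rewrite tensmxDl !tensmxDr tensmx11 !tensmxZl !tensmxZr !mulmxDl mul1mx.
rewrite -!scalemxAl !mxtraceD !mxtraceZ; ring.
Qed.

Lemma tensmxNl m n p q (A : 'M[K]_(m, n)) (D : 'M[K]_(p, q)) : (- A) *t D = - (A *t D).
Proof. by rewrite -scaleN1r tensmxZl scaleN1r. Qed.

Lemma tensmxNr m n p q (A : 'M[K]_(m, n)) (D : 'M[K]_(p, q)) : D *t (- A) = - (D *t A).
Proof. by rewrite -scaleN1r tensmxZr scaleN1r. Qed.

Lemma mxtrace_tens_diff d (P P' Q Q' : 'M[K]_d) (rho : 'M[K]_(d * d)) :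
  \tr (((P - P') *t (Q - Q')) *m rho) =
  (\tr ((P *t Q) *m rho) - \tr ((P *t Q') *m rho)) -
  (\tr ((P' *t Q) *m rho) - \tr ((P' *t Q') *m rho)).
Proof.
rewrite tensmxDl tensmxNl !tensmxDr !tensmxNr mulmxBl !mulmxDl !mulNmx.
by rewrite !(mxtraceD, linearN mxtrace) /= !(mxtraceD, linearN mxtrace) /=.
Qed.

End Tensor.

(** * From a correlation matrix to a quantum behavior with unbiased marginals *)

Section Dilation.
Variable R : realType.
Local Notation C := R[i].
Local Open Scope complex_scope.

Definition effect d (M : 'M[C]_d) (a : 'I_2) : 'M[C]_d :=
  2^-1 *: (1%:M + (sgn2 R a)%:C *: M).

Lemma effect_sum d (M : 'M[C]_d) : \sum_a effect M a = 1%:M.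
Proof.
rewrite big_ord_recl big_ord1 /effect /sgn2 /= -scalerDr rmorphN rmorph1.
rewrite scaleN1r scale1r addrACA addrN addr0 -mulr2n -(scaler_nat 2 1%:M) scalerA mulVf ?scale1r //.
by rewrite pnatr_eq0.
Qed.

Lemma effect_psd d (M : 'M[C]_d) a :
  psd (1%:M + M) -> psd (1%:M - M) -> psd (effect M a).
Proof.
move=> hp hm; apply: psdZ; first by rewrite invr_ge0 ler0n.
rewrite /sgn2; case: ifP => _; last by rewrite rmorphN rmorph1 scaleN1r.
by rewrite rmorph1 scale1r.
Qed.

Lemma effect_corr d (M N : 'M[C]_d) (rho : 'M[C]_(d * d)) a b :
  \tr rho = 1 ->
  \tr ((effect M a *t effect N b) *m rho) =
  4^-1 * (1 + (sgn2 R a)%:C * \tr ((M *t 1%:M) *m rho)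
   + (sgn2 R b)%:C * \tr ((1%:M *t N) *m rho)
   + (sgn2 R a)%:C * (sgn2 R b)%:C * \tr ((M *t N) *m rho)).
Proof.
move=> t1; rewrite /effect tensmxZl tensmxZr scalerA -invfM -natrM -scalemxAl mxtraceZ.
by rewrite mxtrace_tens_affine t1.
Qed.

(** Cyclicity of the trace moves the factor [K *t L] from the state to the observables. *)
Lemma mxtrace_compress p d (K L : 'M[C]_(p, d)) (X Y : 'M[C]_d) (X' Y' : 'M[C]_p) rho :
  K *m X *m adjmx K = X' -> L *m Y *m adjmx L = Y' ->
  \tr ((X *t Y) *m (adjmx (K *t L) *m rho *m (K *t L))) = \tr ((X' *t Y') *m rho).
Proof.
move=> <- <-.
by rewrite !mulmxA mxtrace_mulC !mulmxA adjmx_tens !tensmx_mul.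
Qed.

Lemma block_isometries d : exists K0 K1 : 'M[C]_(d, d + d),
  [/\ K0 *m adjmx K0 = 1%:M, K0 *m adjmx K1 = 0, K1 *m adjmx K0 = 0,
      K1 *m adjmx K1 = 1%:M & adjmx K0 *m K0 + adjmx K1 *m K1 = 1%:M].
Proof.
exists (row_mx 1%:M 0), (row_mx 0 1%:M).
rewrite !adjmxE !tr_row_mx !map_col_mx !trmx1 !map_mx1 !trmx0 !map_mx0 !mul_row_col.
rewrite !mul_col_row !(mulmx0, mul0mx, mulmx1, add0r, addr0); split=> //.
by rewrite add_block_mx !(add0r, addr0) -scalar_mx_block.
Qed.

(* The dilation [X (+) -X] kills the one-party expectations. *)
Definition dilation d (K0 K1 : 'M[C]_(d, d + d)) (X : 'M[C]_d) (a : 'I_2) :=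
  adjmx K0 *m effect X a *m K0 + adjmx K1 *m effect (- X) a *m K1.

(** The state is the even mixture of two copies of [rho], one on the pair of first blocks and one on
    the pair of second blocks. In the second copy both observables change sign, so the correlators
    agree while the one-party terms cancel. *)
Lemma inCor_has_rep n m (Cm : 'M[R]_(n, m)) :
  inCor Cm -> exists d, has_rep (pC Cm) d.
Proof.
case=> _ [d [_ [M [N [rho [hM [hN [[prho trho] hc]]]]]]]].
have [K0 [K1 [K00 K01 K10 K11 KK]]] := block_isometries d.
have DK0 X a : K0 *m dilation K0 K1 X a *m adjmx K0 = effect X a.
  rewrite /dilation mulmxDr mulmxDl !mulmxA K00 K01 !mul0mx addr0 mul1mx.
  by rewrite -mulmxA K00 mulmx1.
have DK1 X a : K1 *m dilation K0 K1 X a *m adjmx K1 = effect (- X) a.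
  rewrite /dilation mulmxDr mulmxDl !mulmxA K11 K10 !mul0mx add0r mul1mx.
  by rewrite -mulmxA K11 mulmx1.
have Dpsd X a : Defs.hermitian X -> eigs_in_pm1 X -> psd (dilation K0 K1 X a).
  move=> hX eX; have [p1 p2] := contraction_psd hX eX.
  by apply: psdD; apply: psd_conj; apply: effect_psd; rewrite ?opprK.
have Dsum X : \sum_a dilation K0 K1 X a = 1%:M.
  rewrite big_split /= -!mulmx_suml -!mulmx_sumr effect_sum.
  by rewrite (effect_sum (- X)) !mulmx1.
have tK (K : 'M[C]_(d, d + d)) : K *m adjmx K = 1%:M ->
    \tr (adjmx (K *t K) *m rho *m (K *t K)) = 1.
  by move=> KKi; rewrite mxtrace_mulC mulmxA adjmx_tens tensmx_mul KKi tensmx11 mul1mx.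
exists (d + d)%N, (2^-1 *: (adjmx (K0 *t K0) *m rho *m (K0 *t K0)
   + adjmx (K1 *t K1) *m rho *m (K1 *t K1))),
   (fun x => dilation K0 K1 (M x)), (fun y => dilation K0 K1 (N y)).
split; [split | split; [|split; [|split; [|split]]]].
- apply: psdZ; first by rewrite invr_ge0 ler0n.
  by apply: psdD; apply: psd_conj.
- by rewrite mxtraceZ mxtraceD (tK _ K00) (tK _ K11); field.
- by move=> x a; apply: Dpsd; case: (hM x).
- by move=> x; apply: Dsum.
- by move=> y a; apply: Dpsd; case: (hN y).
- by move=> y; apply: Dsum.
move=> a b x y.
rewrite -scalemxAr mxtraceZ mulmxDr mxtraceD.
rewrite (mxtrace_compress rho (DK0 (M x) a) (DK0 (N y) b)).
rewrite (mxtrace_compress rho (DK1 (M x) a) (DK1 (N y) b)).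
rewrite (effect_corr (M x) (N y) a b trho).
rewrite (effect_corr (- M x) (- N y) a b trho).
rewrite tensmxNl !tensmxNr.
rewrite (tensmxNl (M x) (N y)) opprK !mulNmx.
rewrite (linearN mxtrace) (linearN mxtrace).
rewrite -hc.
rewrite /pC !rmorphM rmorphD rmorph1.
rewrite !rmorphM /= fmorphV /= rmorph_nat.
by field.
Qed.

End Dilation.

(** * Lower bound on the dimension of a Clifford module *)

Section CliffordDimension.
Variables (F : fieldType) (im : F).
Hypotheses (imM : im * im = -1) (two_neq0 : 2 != 0 :> F).

Lemma eq_opp_mx0 p q (A : 'M[F]_(p, q)) : A = - A -> A = 0.
Proof.
move=> e; have : 2 *: A = 0 by rewrite scaler_nat mulr2n {1}e addNr.
by move/eqP; rewrite scaler_eq0 (negPf two_neq0) => /eqP.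
Qed.

Lemma mulmx_eq_sub p q N (U : 'M[F]_(p, N)) (W : 'M[F]_(q, N)) (X Y : 'M[F]_N) :
  (W <= U)%MS -> U *m X = U *m Y -> W *m X = W *m Y.
Proof. by case/submxP=> D -> e; rewrite -!mulmxA e. Qed.

(** Each pair of generators doubles the dimension: the last two produce an involution whose two
    eigenspaces in [U] have equal rank, and the remaining generators act on one of them. The
    relations are required only on the row space of [U], which lets the induction pass to that
    eigenspace. *)
Lemma clifford_module_dim k N p (U : 'M[F]_(p, N)) (G : nat -> 'M[F]_N) :
  U != 0 ->
  (forall j, (j < k.*2)%N -> (U *m G j <= U)%MS) ->
  (forall j, (j < k.*2)%N -> U *m (G j *m G j) = U *m 1%:M) ->
  (forall j l, (j < k.*2)%N -> (l < k.*2)%N -> j != l ->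
     U *m (G j *m G l) = U *m (- (G l *m G j))) ->
  (2 ^ k <= \rank U)%N.
Proof.
elim: k p U => [|k IH] p U U0 stU sqU acU; first by rewrite expn0 lt0n mxrank_eq0.
set x := k.*2; set y := k.*2.+1.
have xlt : (x < k.+1.*2)%N by rewrite /x; lia.
have ylt : (y < k.+1.*2)%N by rewrite /y; lia.
have lt j : (j < k.*2)%N -> (j < k.+1.*2)%N by lia.
have xy : x != y by rewrite /x /y; lia.
have jx j : (j < k.*2)%N -> j != x by rewrite /x; lia.
have jy j : (j < k.*2)%N -> j != y by rewrite /y; lia.
have stW q (W : 'M_(q, N)) j : (j < k.+1.*2)%N -> (W <= U)%MS -> (W *m G j <= U)%MS.
  by move=> hj hW; apply: submx_trans (stU _ hj); apply: submxMr.
have sqW q (W : 'M_(q, N)) j : (j < k.+1.*2)%N -> (W <= U)%MS -> W *m G j *m G j = W.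
  by move=> hj hW; rewrite -mulmxA (mulmx_eq_sub hW (sqU _ hj)) mulmx1.
have acW q (W : 'M_(q, N)) j l : (j < k.+1.*2)%N -> (l < k.+1.*2)%N -> j != l ->
    (W <= U)%MS -> W *m G j *m G l = - (W *m G l *m G j).
  by move=> hj hl jl hW; rewrite -!mulmxA (mulmx_eq_sub hW (acU _ _ hj hl jl)) mulmxN.
(* [J] is an involution on [U] commuting with the other generators; [G x]
   anticommutes with it and so swaps its two eigenspaces. *)
pose J := im *: (G x *m G y).
have stJ q (W : 'M_(q, N)) : (W <= U)%MS -> (W *m J <= U)%MS.
  by move=> hW; rewrite -scalemxAr scalemx_sub // mulmxA !stW.
have JJ q (W : 'M_(q, N)) : (W <= U)%MS -> W *m J *m J = W.
  move=> hW; rewrite /J -!scalemxAr -scalemxAl scalerA imM scaleN1r !mulmxA.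
  rewrite (acW _ (W *m G x) y x) ?stW // 1?eq_sym // mulNmx opprK.
  by rewrite (sqW _ W) // (sqW _ W).
have JX q (W : 'M_(q, N)) : (W <= U)%MS -> W *m G x *m J = - (W *m J *m G x).
  move=> hW; rewrite /J -!scalemxAr -scalemxAl -scalerN !mulmxA; congr (_ *: _).
  by rewrite (acW _ (W *m G x) y x) ?stW // 1?eq_sym // opprK.
have JG q (W : 'M_(q, N)) j : (j < k.*2)%N -> (W <= U)%MS -> W *m G j *m J = W *m J *m G j.
  move=> hj hW; rewrite /J -!scalemxAr -scalemxAl !mulmxA; congr (_ *: _).
  rewrite (acW _ W j x (lt _ hj) xlt (jx _ hj) hW) mulNmx.
  by rewrite (acW _ _ j y (lt _ hj) ylt (jy _ hj) (stW _ _ _ xlt hW)) opprK.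
clearbody J.
(* On [U] this is the projection onto the eigenspace of [J] for the eigenvalue 1. *)
pose P := 2^-1 *: (1%:M + J).
have PJ q (W : 'M_(q, N)) : (W <= U)%MS -> W *m P *m J = W *m P.
  move=> hW; rewrite /P -!scalemxAr -scalemxAl; congr (_ *: _).
  by rewrite mulmxDr mulmx1 mulmxDl JJ // addrC.
have UP : (U *m P <= U)%MS.
  by rewrite -scalemxAr scalemx_sub // mulmxDr mulmx1 addmx_sub ?stJ.
have UP0 : U *m P != 0.
  (* If [U *m P] vanished, [J] would be -1 on all of [U], hence on [U *m G x] too; anticommutation
     of [J] and [G x] then gives [U *m G x = 0], although [G x] squares to 1 on [U]. *)
  apply: contra U0 => /eqP UP0; have UJ : U *m J = U *m (- 1%:M).
    apply/eqP; rewrite mulmxN mulmx1 -addr_eq0 addrC; apply/eqP.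
    have := congr1 (fun A => 2 *: A) UP0.
    by rewrite scaler0 /P -scalemxAr scalerA divff // scale1r mulmxDr mulmx1.
  have UX : U *m G x = 0.
    apply: eq_opp_mx0; have := JX _ U (submx_refl _).
    rewrite (mulmx_eq_sub (stU _ xlt) UJ) UJ !mulmxN !mulmx1 mulNmx opprK.
    by move=> e; rewrite -{1}e.
  by rewrite -(sqW _ U x) // UX mul0mx.
have hr : (2 ^ k <= \rank (U *m P))%N.
  apply: IH => // [j hj|j hj|j l hj hl jl].
  - have -> : U *m P *m G j = U *m G j *m P.
      by rewrite /P -!scalemxAr -scalemxAl !mulmxDr !mulmx1 mulmxDl JG.
    by rewrite submxMr // stU // lt.
  - by apply: (mulmx_eq_sub UP); apply: sqU; rewrite lt.
  - by apply: (mulmx_eq_sub UP); apply: acU; rewrite ?lt.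
(* [J] acts as 1 on the first space and as -1 on the second. *)
have hcap : (U *m P :&: U *m P *m G x)%MS = 0.
  set W := (_ :&: _)%MS.
  have W1 : (W <= U *m P)%MS by apply: capmxSl.
  have W2 : (W <= U *m P *m G x)%MS by apply: capmxSr.
  apply: eq_opp_mx0; rewrite -{1}[W]mulmx1.
  have <- : W *m J = W *m 1%:M by apply: (mulmx_eq_sub W1); rewrite PJ // mulmx1.
  rewrite -[RHS]mulmx1 mulNmx -mulmxN.
  by apply: (mulmx_eq_sub W2); rewrite JX // PJ // mulmxN mulmx1.
(* [G x] is its own inverse on [U]. *)
have hX : \rank (U *m P *m G x) = \rank (U *m P).
  apply/eqP; rewrite eqn_leq mxrankM_maxl /=.
  by rewrite -{1}(sqW _ _ _ xlt UP) mxrankM_maxl.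
have : (\rank (U *m P + U *m P *m G x)%MS <= \rank U)%N.
  by apply: mxrankS; rewrite addsmx_sub UP stW.
have := mxrank_sum_cap (U *m P) (U *m P *m G x).
rewrite hcap mxrank0 addn0 hX addnn => -> h.
by apply: leq_trans h; rewrite expnS mul2n leq_double.
Qed.

End CliffordDimension.

(** * Real symmetric Clifford generators and the maximally entangled vector *)

Section CliffordGenerators.
Variable F : comPzRingType.

(** Doubling the size replaces each old generator by [diag (G i, - G i)], with which the block swap
    anticommutes; the swap becomes the new generator. All these matrices are symmetric, so
    transposes disappear from the maximally entangled trace formula. *)
Lemma clifford_generators k : exists d (G : nat -> 'M[F]_d), (0 < d)%N /\
  (forall i, (G i)^T = G i) /\
  (forall i j, (i < k)%N -> (j < k)%N -> G i *m G j + G j *m G i = (2 * (i == j)%:R)%:M).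
Proof.
elim: k => [|k [d [G [d0 [symG relG]]]]]; first by exists 1%N, (fun=> 0); split=> //; split=> // i; rewrite trmx0.
exists (d + d)%N, (fun i => if (i < k)%N then block_mx (G i) 0 0 (- G i)
                            else block_mx 0 1%:M 1%:M 0).
split; first by rewrite addn_gt0 d0.
split=> [i|i j]; first by case: ifP => _; rewrite tr_block_mx ?trmx0 ?trmx1 // (linearN trmx) /= symG.
have sc a : (a%:M : 'M[F]_(d + d)) = block_mx a%:M 0 0 a%:M by rewrite scalar_mx_block.
rewrite !ltnS leq_eqVlt => /orP[/eqP->|hi]; rewrite leq_eqVlt => /orP[/eqP->|hj].
- rewrite ltnn !mulmx_block !(mulmx0, mul0mx, mulmx1, add0r, addr0) eqxx mulr1.
  by rewrite add_block_mx !addr0 sc -raddfD.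
- rewrite ltnn hj !mulmx_block !(mulmx0, mul0mx, mulmx1, mul1mx, add0r, addr0).
  rewrite add_block_mx !(add0r, addr0) addrN addNr (gtn_eqF hj) mulr0 sc.
  by rewrite -scalemx1 scale0r.
- rewrite ltnn hi !mulmx_block !(mulmx0, mul0mx, mulmx1, mul1mx, add0r, addr0).
  rewrite add_block_mx !(add0r, addr0) addrN addNr (ltn_eqF hi) mulr0 sc.
  by rewrite -scalemx1 scale0r.
- rewrite hi hj !mulmx_block !(mulmx0, mul0mx, add0r, addr0) !mulmxN !mulNmx !opprK.
  by rewrite add_block_mx !(add0r, addr0) relG // sc.
Qed.

(** The unnormalised maximally entangled vector, the sum of the [e_i (x) e_i]. *)
Definition diag_vec d : 'rV[F]_(d * d) :=
  \row_k ((mxtens_unindex k).1 == (mxtens_unindex k).2)%:R.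

Lemma sum_diag_vec d (f : 'I_(d * d) -> F) :
  \sum_k diag_vec d 0 k * f k = \sum_i f (mxtens_index (i, i)).
Proof.
rewrite (reindex (@mxtens_index d d)) /=; last first.
  by exists (@mxtens_unindex d d) => i _; rewrite ?mxtens_indexK ?mxtens_unindexK.
rewrite (eq_bigr (fun p => (p.1 == p.2)%:R * f (mxtens_index (p.1, p.2)))); last first.
  by move=> [i j] _; rewrite mxE mxtens_indexK.
rewrite -(pair_bigA _ (fun i j => (i == j)%:R * f (mxtens_index (i, j)))) /=.
apply: eq_bigr => i _; rewrite (bigD1 i) //= eqxx mul1r big1 ?addr0 // => j.
by rewrite eq_sym => /negPf->; rewrite mul0r.
Qed.

Lemma mxtrace_diag_vec d (A B : 'M[F]_d) :
  \tr ((A *t B) *m ((diag_vec d)^T *m diag_vec d)) = \tr (A *m B^T).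
Proof.
rewrite mulmxA mxtrace_mulC mulmxA /mxtrace big_ord1 mxE.
rewrite (eq_bigr (fun k => diag_vec d 0 k * \sum_i (A *t B) (mxtens_index (i, i)) k)).
  rewrite sum_diag_vec exchange_big /=; apply: eq_bigr => i _.
  by rewrite !mxE; apply: eq_bigr => j _; rewrite tensmxE !mxE.
by move=> k _; rewrite mulrC [X in X * _]mxE [X in _ * X]mxE sum_diag_vec.
Qed.

End CliffordGenerators.

(** * Positivity of squared norms read off Gram matrices *)

Section GramDiagonal.
Variable R : realFieldType.

Lemma gram_rowE n k (u : 'M[R]_(n, k)) x : (u *m u^T) x x = \sum_i u x i ^+ 2.
Proof. by rewrite mxE; apply: eq_bigr => i _; rewrite mxE expr2. Qed.

Lemma gram_ge0 n k (u : 'M[R]_(n, k)) x : 0 <= (u *m u^T) x x.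
Proof. by rewrite gram_rowE sumr_ge0 // => i _; apply: sqr_ge0. Qed.

Lemma gram_row_eq0 n k (u : 'M[R]_(n, k)) x : (u *m u^T) x x = 0 -> row x u = 0.
Proof.
rewrite gram_rowE => /eqP; rewrite psumr_eq0 => [/allP h|i _]; last exact: sqr_ge0.
apply/rowP=> i; rewrite !mxE; have := h i (mem_index_enum _).
by rewrite sqrf_eq0 => /eqP.
Qed.

Lemma gram_col k (z : 'cV[R]_k) : z^T *m z = ((z^T *m z) 0 0)%:M.
Proof. by apply/matrixP=> i j; rewrite !ord1 [RHS]mxE eqxx mulr1n. Qed.

Lemma gram_col_gt0 k (z : 'cV[R]_k) : z != 0 -> 0 < (z^T *m z) 0 0.
Proof.
move=> z0; have -> : z^T *m z = z^T *m (z^T)^T by rewrite trmxK.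
rewrite lt_def gram_ge0 andbT; apply: contra z0 => /eqP /gram_row_eq0.
by rewrite row_id => /(congr1 trmx); rewrite trmxK trmx0 => ->.
Qed.
End GramDiagonal.

(** * Tsirelson's construction: inner products realised as quantum correlations *)

Section VectorCorrelations.
Variable R : realType.
Local Notation C := R[i].
Local Open Scope complex_scope.

(** Tsirelson's vector description of Cor. The vectors are the rows of [u] and [v], in any
    dimension, and the squared norms are diagonal entries of Gram matrices. *)
Definition vec_corr n m (Cm : 'M[R]_(n, m)) : Prop :=
  exists k (u : 'M[R]_(n, k)) (v : 'M[R]_(m, k)),
  [/\ forall x, (u *m u^T) x x <= 1, forall y, (v *m v^T) y y <= 1 & Cm = u *m v^T].

Lemma dot_le1 n m k (u : 'M[R]_(n, k)) (v : 'M[R]_(m, k)) x y :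
  (u *m u^T) x x <= 1 -> (v *m v^T) y y <= 1 -> -1 <= (u *m v^T) x y <= 1.
Proof.
rewrite !gram_rowE [X in _ <= X <= _]mxE => hu hv.
(* The right-hand side is the squared norm of [u_x + s v_y]; the signs [s = 1] and [s = -1] give the
   two bounds. *)
have h s : s ^+ 2 = 1 -> 0 <= \sum_i u x i ^+ 2 + \sum_i v y i ^+ 2 + 2 * s * \sum_i u x i * v^T i y.
  move=> s1; rewrite mulr_sumr -!big_split /= sumr_ge0 // => i _.
  have -> : u x i ^+ 2 + v y i ^+ 2 + 2 * s * (u x i * v^T i y) = (u x i + s * v y i) ^+ 2.
    by rewrite mxE sqrrD exprMn s1; ring.
  exact: sqr_ge0.
have h1 := h 1 (expr1n _ _); have h2 := h (-1) (etrans (sqrrN 1) (expr1n _ _)).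
by apply/andP; split; lra.
Qed.

Lemma sqr_scalar_eigs d (A : 'M[C]_d) (c : R) :
  0 <= c <= 1 -> A *m A = (c%:C)%:M -> eigs_in_pm1 A.
Proof.
move=> /andP[c0 c1] AA a /eigenvalueP[v e v0].
have : a ^+ 2 = ((Num.sqrt c)%:C) ^+ 2.
  rewrite -rmorphXn sqr_sqrtr //=; apply/eqP; rewrite -subr_eq0.
  have : (a ^+ 2 - c%:C) *: v == 0.
    by rewrite scalerBl expr2 -scalerA -e scalemxAl -e -mulmxA AA mul_mx_scalar subrr.
  by rewrite scaler_eq0 (negPf v0) orbF.
have s1 : Num.sqrt c <= 1 by rewrite -sqrtr1 ler_wsqrtr.
have s0 := sqrtr_ge0 c.
have N1 : (-1 : C) = (-1)%:C by rewrite rmorphN rmorph1.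
have P1 : (1 : C) = 1%:C by rewrite rmorph1.
move/eqP; rewrite eqf_sqr => /orP[/eqP->|/eqP->].
  by rewrite N1 [X in _ && (_ <= X)]P1 !lecR s1 andbT; lra.
by rewrite N1 -(rmorphN _ (Num.sqrt c)) [X in _ && (_ <= X)]P1 !lecR; apply/andP; split; lra.
Qed.

(** A vector [w] becomes the observable [S w], the combination of the generators with coefficients
    [w]. Its square is the scalar [|w|^2], which bounds the eigenvalues, and anticommutators give
    inner products, which the maximally entangled state reads off as traces. *)
Lemma vec_corr_inCor n m (Cm : 'M[R]_(n, m)) : vec_corr Cm -> inCor Cm.
Proof.
case=> k [u [v [nu nv ->]]]; split=> [x y|]; first exact: dot_le1.
have [d [G [d0 [symG relG]]]] := clifford_generators R k.
pose S p (w : 'M[R]_(p, k)) x := \sum_(i < k) w x i *: G i.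
have Ssym p (w : 'M_(p, k)) x : (S p w x)^T = S p w x.
  by rewrite linear_sum; apply: eq_bigr => i _; rewrite linearZ /= symG.
have Sac p q (w : 'M_(p, k)) (w' : 'M_(q, k)) x y :
    S p w x *m S q w' y + S q w' y *m S p w x = (2 * (w *m w'^T) x y)%:M.
  rewrite /S !mulmx_suml [X in _ + X](eq_bigr
    (fun j : 'I_k => \sum_(i < k) (w' y j *: G j) *m (w x i *: G i))); last first.
    by move=> j _; rewrite mulmx_sumr.
  rewrite [X in _ + X]exchange_big -big_split /=.
  rewrite mxE mulr_sumr raddf_sum /=; apply: eq_bigr => i _.
  rewrite mulmx_sumr -big_split /= (bigD1 i) //= big1 ?addr0 => [|j ji].
    rewrite -!scalemxAr -!scalemxAl !scalerA [w' y i * _]mulrC -scalerDr relG // eqxx.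
    by rewrite scale_scalar_mx [w'^T i y]mxE; congr _%:M; rewrite mulr1; ring.
  rewrite -!scalemxAr -!scalemxAl !scalerA [w' y j * _]mulrC -scalerDr relG //.
  by rewrite val_eqE eq_sym (negPf ji) mulr0 -scalemx1 scale0r scaler0.
have S2 p (w : 'M_(p, k)) x : S p w x *m S p w x = ((w *m w^T) x x)%:M.
  have d2 : (2 : R) != 0 by rewrite pnatr_eq0.
  apply: (scalerI d2); rewrite scale_scalar_mx -(Sac _ _ w w x x).
  by rewrite -mulr2n scaler_nat.
pose T p w x := map_mx (real_complex R) (S p w x).
have Therm p (w : 'M_(p, k)) x : Defs.hermitian (T p w x).
  apply/matrixP=> i j; rewrite !mxE -[in RHS](Ssym _ w x) mxE.
  by rewrite conj_Creal // complex_real.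
have Teig p (w : 'M_(p, k)) x : (w *m w^T) x x <= 1 -> eigs_in_pm1 (T p w x).
  move=> hw; apply: (@sqr_scalar_eigs _ _ ((w *m w^T) x x)).
    by rewrite hw gram_rowE sumr_ge0 // => i _; apply: sqr_ge0.
  by rewrite -map_mxM S2 map_scalar_mx.
have dC : (d%:R : C) != 0 by rewrite pnatr_eq0 -lt0n.
have aq : adjmx (diag_vec C d) = (diag_vec C d)^T.
  by apply/matrixP=> i j; rewrite !mxE conj_Creal // realn.
exists d; split=> //; exists (T n u), (T m v),
  (d%:R^-1 *: (adjmx (diag_vec C d) *m diag_vec C d)).
split; [|split; [|split]] => [x|y||x y]; first by split; [|apply: Teig].
- by split; [|apply: Teig].
- split; first by apply: psdZ; [rewrite invr_ge0 ler0n | apply: psd_adjM].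
  rewrite mxtraceZ aq -[_ *m _]mul1mx -tensmx11 mxtrace_diag_vec trmx1 mulmx1 mxtrace1.
  by rewrite mulVf.
rewrite -scalemxAr mxtraceZ aq mxtrace_diag_vec map_trmx Ssym -map_mxM trace_map_mx.
(* Both orders of the product have the same trace, so this is half the trace of the
   anticommutator. *)
have -> : \tr (S n u x *m S m v y) = d%:R * (u *m v^T) x y.
  have := congr1 mxtrace (Sac n m u v x y).
  rewrite mxtraceD [X in _ + X]mxtrace_mulC mxtrace_scalar => e.
  have d2 : (2 : R) != 0 by rewrite pnatr_eq0.
  apply: (mulfI d2); rewrite [RHS]mulrCA [RHS](mulr_natl _ d) -e; ring.
by rewrite rmorphM /= rmorph_nat mulKf.
Qed.

End VectorCorrelations.

(** * Real Gram factors of small symmetric perturbations of the identity *)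

Section RealPsd.
Variable R : realType.
Local Notation C := R[i].
Local Open Scope complex_scope.

Lemma Re_add (a b : C) : complex.Re (a + b) = complex.Re a + complex.Re b.
Proof. by case: a => ? ?; case: b. Qed.

Lemma Re_sum I (r : seq I) (P : pred I) (f : I -> C) :
  complex.Re (\sum_(i <- r | P i) f i) = \sum_(i <- r | P i) complex.Re (f i).
Proof. exact: (big_morph _ Re_add). Qed.

Lemma Re_conjM (a b : C) : complex.Re (a^*%R * b) =
  complex.Re a * complex.Re b + complex.Im a * complex.Im b.
Proof. by case: a => ? ?; case: b => ? ? /=; rewrite mulNr opprK. Qed.

(** The real and imaginary parts of a complex factor [Q], placed side by side, have Gram matrix the
    real part of [adjmx Q *m Q]. This accounts for the width [k + k]. *)
Lemma psd_real_factor k (P : 'M[R]_k) : psd (map_mx (real_complex R) P) ->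
  exists Y : 'M[R]_(k, k + k), P = Y *m Y^T.
Proof.
case/psd_factor=> Q eP.
exists (row_mx (map_mx (@complex.Re R) Q)^T (map_mx (@complex.Im R) Q)^T).
rewrite tr_row_mx !trmxK mul_row_col.
apply/matrixP=> i j; have := congr1 (fun M : 'M[C]_k => complex.Re (M i j)) eP.
rewrite [in LHS]mxE /= => ->; rewrite !mxE Re_sum -big_split /=.
by apply: eq_bigr => l _; rewrite !mxE Re_conjM.
Qed.

Lemma psd_perturb k (X : 'M[R]_k) (s : R) : X^T = X ->
  `|s| * (\sum_i \sum_j `|X i j|) <= 1 ->
  psd (map_mx (real_complex R) (1%:M + s *: X)).
Proof.
move=> symX hs.
have herm : Defs.hermitian (map_mx (real_complex R) (1%:M + s *: X)).
  apply/matrixP=> i j; rewrite !mxE -[in X j i]symX mxE eq_sym.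
  by rewrite conj_Creal // complex_real.
split=> // v.
pose T : C := \sum_i `|v i 0| ^+ 2; pose w : C := s%:C * \sum_i \sum_j (v i 0)^*%R * (X i j)%:C * v j 0.
have -> : (adjmx v *m map_mx (real_complex R) (1%:M + s *: X) *m v) 0 0 = T + w.
  rewrite map_mxD map_mx1 map_mxZ mulmxDr mulmxDl mulmx1 -scalemxAr -scalemxAl.
  rewrite mxE; congr (_ + _).
    by rewrite mxE; apply: eq_bigr => i _; rewrite mxE normCKC.
  rewrite [LHS]mxE; congr (_ * _); rewrite -mulmxA mxE; apply: eq_bigr => i _.
  by rewrite !mxE mulr_sumr; apply: eq_bigr => j _; rewrite mxE mulrA.
have T0 : 0 <= T by apply: sumr_ge0 => i _; apply: exprn_ge0.
(* By symmetry of [X], conjugation only exchanges the two summation indices. *)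
have wr : w \is Num.real.
  rewrite CrealE /w rmorphM rmorph_sum /=; apply/eqP; congr (_ * _).
    by rewrite conj_Creal // complex_real.
  rewrite exchange_big; apply: eq_bigr => i _; rewrite rmorph_sum; apply: eq_bigr => j _.
  rewrite !rmorphM /= conjCK [((X _ _)%:C)^*%R]conj_Creal ?complex_real //.
  have -> : X i j = X j i by rewrite -{1}symX mxE.
  ring.
have vv i j : `|v i 0| * `|v j 0| <= T.
  have hv l : `|v l 0| ^+ 2 <= T.
    by rewrite /T (bigD1 l) //= lerDl sumr_ge0 // => l' _; apply: exprn_ge0.
  have h : 0 <= (`|v i 0| - `|v j 0|) ^+ 2.
    by apply: real_exprn_even_ge0 => //; rewrite rpredB ?normr_real.
  have h2 : (`|v i 0| * `|v j 0|) *+ 2 <= T *+ 2.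
    rewrite mulr2n -mulr2n; apply: le_trans (lerD (hv i) (hv j)).
    by rewrite -subr_ge0 addrAC -sqrrB.
  by rewrite lerMn2r in h2.
(* Each [|v_i| |v_j|] is at most [T = |v|^2], so the perturbation is at most [|s|] times the sum of
   the [|X i j|], times [T]. *)
have : `|w| <= T.
  rewrite normrM; apply: (@le_trans _ _ (`|s%:C| * \sum_i \sum_j `|(X i j)%:C| * T)).
    apply: ler_wpM2l => //; apply: le_trans (ler_norm_sum _ _ _) _; apply: ler_sum => i _.
    apply: le_trans (ler_norm_sum _ _ _) _; apply: ler_sum => j _.
    by rewrite !normrM norm_conjC mulrAC mulrC ler_wpM2l.
  have -> : `|s%:C| * \sum_i \sum_j `|(X i j)%:C| * T = (`|s| * \sum_i \sum_j `|X i j|)%:C * T.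
    have nR (x : R) : `|x%:C| = (`|x|)%:C by rewrite normc_def /= expr0n addr0 sqrtr_sqr.
    rewrite rmorphM nR -mulrA; congr (_ * _); rewrite rmorph_sum mulr_suml; apply: eq_bigr => i _.
    by rewrite rmorph_sum mulr_suml; apply: eq_bigr => j _; rewrite nR.
  by rewrite ler_piMl // -(rmorph1 (real_complex R)) lecR.
by move/(real_lerNnormlW wr); rewrite -subr_ge0 opprK addrC.
Qed.

Lemma sym_perturb k (X : 'M[R]_k) : X^T = X ->
  exists e (Y Y' : 'M[R]_(k, k + k)),
    [/\ e != 0, 1%:M + e *: X = Y *m Y^T & 1%:M - e *: X = Y' *m Y'^T].
Proof.
move=> symX; pose S := \sum_i \sum_j `|X i j|.
have S0 : 0 <= S by rewrite sumr_ge0 // => i _; rewrite sumr_ge0.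
have S1 : 0 < 1 + S by lra.
have hS : `|(1 + S)^-1| * S <= 1.
  rewrite gtr0_norm ?invr_gt0 // [_ * S]mulrC ler_pdivrMr // mul1r; lra.
have [Y eY] := psd_real_factor (psd_perturb symX hS).
have [|Y' eY'] := psd_real_factor (@psd_perturb _ X (- (1 + S)^-1) symX _).
  by rewrite normrN.
exists (1 + S)^-1, Y, Y'; split=> //; first by rewrite invr_eq0 gt_eqF.
by rewrite -eY' scaleNr.
Qed.

End RealPsd.

(** * What extremality forces on the vectors behind a correlation matrix *)

Section Extreme.
Variable R : realType.

(** Extremality in midpoint form, tested on Gram blocks only, so that later arguments merely move
    vectors. *)
Definition mid_extreme n m (Cm : 'M[R]_(n, m)) : Prop :=
  forall D, vec_corr (Cm + D) -> vec_corr (Cm - D) -> D = 0.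

Lemma extreme_mid_extreme n m (Cm : 'M[R]_(n, m)) : extreme_Cor Cm -> mid_extreme Cm.
Proof.
case=> _ ext D /vec_corr_inCor h1 /vec_corr_inCor h2.
have [] := ext _ _ (2^-1) h1 h2; first by lra.
  have -> : 1 - 2^-1 = 2^-1 :> R by lra.
  rewrite -scalerDr addrACA subrr addr0 -mulr2n -scaler_nat scalerA mulVf ?scale1r //.
  by rewrite pnatr_eq0.
by move/(canRL (addKr _)); rewrite addNr.
Qed.

Lemma vec_corr_tr n m (Cm : 'M[R]_(n, m)) : vec_corr Cm -> vec_corr Cm^T.
Proof. by case=> k [u [v [hu hv ->]]]; exists k, v, u; rewrite trmx_mul trmxK. Qed.

Lemma mid_extreme_tr n m (Cm : 'M[R]_(n, m)) : mid_extreme Cm -> mid_extreme Cm^T.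
Proof.
move=> h D /vec_corr_tr h1 /vec_corr_tr h2; apply: trmx_inj; rewrite trmx0.
by apply: h; rewrite ?linearD ?linearN /= trmxK in h1 h2.
Qed.

(* If [u_x] is short, moving it by [+-e v_y] moves [Cm] along row [x]. *)
Lemma mid_extreme_norm n m k (u : 'M[R]_(n, k)) (v : 'M[R]_(m, k)) x :
  mid_extreme (u *m v^T) -> (forall x, (u *m u^T) x x <= 1) ->
  (forall y, (v *m v^T) y y <= 1) -> v != 0 -> (u *m u^T) x x = 1.
Proof.
move=> ext hu hv v0; apply/eqP; case: ltgtP (hu x) => // lt1 _.
suff : v = 0 by move/eqP; rewrite (negPf v0).
apply/row_matrixP => y; rewrite row0.
(* The moved row has squared norm at most [(1 - 3 e) + e^2 + 2 e], which does not exceed 1 because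
   [e <= 1/3]. *)
pose e := (1 - (u *m u^T) x x) / 3.
have e0 : 0 < e by rewrite divr_gt0 // subr_gt0.
have e3 : (u *m u^T) x x = 1 - 3 * e by rewrite /e; field.
have e1 : 3 * e <= 1 by have := gram_ge0 u x; rewrite e3; lra.
pose D : 'M[R]_(n, k) := delta_mx x 0 *m row y v.
have DE a i : D a i = (a == x)%:R * v y i.
  by rewrite mxE big_ord1 !mxE eqxx andbT.
clearbody D.
have hvc s : `|s| = e -> vec_corr (u *m v^T + s *: D *m v^T).
  move=> hs; exists k, (u + s *: D), v; split=> //; last by rewrite mulmxDl.
  move=> a; case: (eqVneq a x) => [->|ax]; last first.
    rewrite gram_rowE (eq_bigr (fun i => u a i ^+ 2)) -?gram_rowE // => i _.
    by rewrite mxE [(s *: D) a i]mxE DE (negPf ax) mul0r mulr0 addr0.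
  rewrite gram_rowE (eq_bigr (fun i => u x i ^+ 2 + (s ^+ 2 * v y i ^+ 2 + 2 * s * (u x i * v^T i y)))); last first.
    by move=> i _; rewrite [(u + _) x i]mxE [(s *: D) x i]mxE DE eqxx mul1r [v^T i y]mxE; ring.
  rewrite !big_split /= -!mulr_sumr -!gram_rowE.
  have := dot_le1 (hu x) (hv y); rewrite [X in _ <= X <= _]mxE => /andP[].
  set c := \sum_i _ => c1 c2.
  have g0 := gram_ge0 v y; have := hv y; move: g0; set g := (v *m v^T) y y => g0 g1.
  have s2 : s ^+ 2 = e ^+ 2 by rewrite -hs real_normK ?num_real.
  have sc : s * c <= e.
    apply: le_trans (ler_norm _) _; rewrite normrM hs.
    by rewrite ler_piMr ?(ltW e0) // ler_norml c1 c2.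
  by rewrite e3 s2; nra.
have D0 : e *: D *m v^T = 0.
  apply: ext; first by apply: hvc; rewrite gtr0_norm.
  by rewrite -mulNmx -scaleNr; apply: hvc; rewrite normrN gtr0_norm.
(* Entry [(x, y)] of [D *m v^T] is the squared norm of [v_y]. *)
apply: gram_row_eq0; have := congr1 (fun M : 'M_(n, m) => M x y) D0.
rewrite -scalemxAl mxE [RHS]mxE => /eqP; rewrite mulf_eq0 (gt_eqF e0) /= => /eqP <-.
by rewrite !mxE; apply: eq_bigr => i _; rewrite DE eqxx mul1r.
Qed.

(* Otherwise projecting the [u_x] off a direction orthogonal to all [v_y] keeps
   [Cm] and shortens some [u_x]. *)
Lemma mid_extreme_span n m k (u : 'M[R]_(n, k)) (v : 'M[R]_(m, k)) :
  mid_extreme (u *m v^T) -> (forall x, (u *m u^T) x x <= 1) ->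
  (forall y, (v *m v^T) y y <= 1) -> v != 0 -> (u <= v)%MS.
Proof.
move=> ext hu hv v0; apply/negPn/negP; rewrite submxE.
case/matrix0Pn => x [j]; set z := col j (cokermx v) => hz.
have vz : v *m z = 0 by rewrite /z colE mulmxA mulmx_coker mul0mx.
have uz : (u *m z) x 0 != 0.
  by rewrite /z colE mulmxA -colE mxE.
have z0 : z != 0 by apply: contra uz => /eqP->; rewrite mulmx0 mxE.
have c0 := gram_col_gt0 z0; set c := (z^T *m z) 0 0 in c0.
(* The rows of [u] projected orthogonally to [z]; row [x] loses [(u z)_x^2 / c], a positive amount,
   from its squared norm. *)
pose u' := u - c^-1 *: (u *m z *m z^T).
have eC : u' *m v^T = u *m v^T.
  by rewrite mulmxBl -scalemxAl -(mulmxA (u *m z)) -trmx_mul vz trmx0 mulmx0 scaler0 subr0.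
have eN : u' *m u'^T = u *m u^T - c^-1 *: (u *m z *m (u *m z)^T).
  rewrite {2}/u' linearB linearZ /= mulmxBr -scalemxAr [in X in _ - X]trmx_mul trmxK.
  have -> : u' *m (z *m (u *m z)^T) = 0.
    rewrite mulmxA mulmxBl -scalemxAl -(mulmxA (u *m z)) gram_col -/c mul_mx_scalar.
    by rewrite scalerA mulVf ?gt_eqF // scale1r subrr mul0mx.
  by rewrite scaler0 subr0 mulmxBl -scalemxAl [(u *m z)^T]trmx_mul !mulmxA.
have eNE a : (u' *m u'^T) a a = (u *m u^T) a a - c^-1 * (u *m z) a 0 ^+ 2.
  rewrite eN [LHS]mxE [X in _ + X]mxE [X in _ - X]mxE; congr (_ - _ * _).
  by rewrite [LHS]mxE big_ord1 [(_ *m z)^T _ _]mxE expr2.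
have ci : 0 < c^-1 by rewrite invr_gt0.
have hu' a : (u' *m u'^T) a a <= 1.
  rewrite eNE; apply: le_trans (hu a); rewrite lerBlDr lerDl mulr_ge0 ?(ltW ci) //.
  exact: sqr_ge0.
(* The projected vectors give the same matrix, so [mid_extreme_norm] applies to them too: both norms
   are 1 and no loss is possible. *)
have := eNE x; rewrite (mid_extreme_norm x ext hu hv v0).
rewrite (mid_extreme_norm x _ hu' hv v0) ?eC // => /eqP.
rewrite eq_sym subr_eq addrC -subr_eq subrr eq_sym mulf_eq0 invr_eq0 gt_eqF //=.
by rewrite sqrf_eq0 (negPf uz).
Qed.

(** Replacing the inner product by [1 + e X] or [1 - e X] leaves the norms of all [u_x] and [v_y]
    unchanged and moves the correlation matrix by [e u X v^T] in opposite directions. This is the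
    dual form of the spanning statement for the [u_x u_x^T] and [v_y v_y^T]. *)
Lemma mid_extreme_sym n m k (u : 'M[R]_(n, k)) (v : 'M[R]_(m, k)) (X : 'M[R]_k) :
  mid_extreme (u *m v^T) -> (forall x, (u *m u^T) x x <= 1) ->
  (forall y, (v *m v^T) y y <= 1) -> X^T = X ->
  (forall x, (u *m X *m u^T) x x = 0) -> (forall y, (v *m X *m v^T) y y = 0) ->
  u *m X *m v^T = 0.
Proof.
move=> ext hu hv symX uX vX.
have [e [Y [Y' [e0 eY eY']]]] := sym_perturb symX.
have nrm p q (w : 'M[R]_(p, k)) (w' : 'M[R]_(q, k)) (s : R) (Z : 'M[R]_(k, k + k)) :
    1%:M + s *: X = Z *m Z^T -> w *m Z *m (w' *m Z)^T = w *m w'^T + s *: (w *m X *m w'^T).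
  move=> eZ; rewrite trmx_mul mulmxA -(mulmxA w) -eZ mulmxDr mulmx1 mulmxDl.
  by rewrite -scalemxAr -scalemxAl.
have vc s (Z : 'M_(k, k + k)) : 1%:M + s *: X = Z *m Z^T -> vec_corr (u *m v^T + s *: (u *m X *m v^T)).
  move=> eZ; exists (k + k)%N, (u *m Z), (v *m Z); split=> [x|y|]; last by rewrite (nrm _ _ _ _ s).
    by rewrite (nrm _ _ _ _ s) // mxE [X in _ + X]mxE uX mulr0 addr0.
  by rewrite (nrm _ _ _ _ s) // mxE [X in _ + X]mxE vX mulr0 addr0.
have : e *: (u *m X *m v^T) = 0.
  apply: ext; first exact: vc eY.
  by rewrite -scaleNr; apply: (vc _ Y'); rewrite scaleNr.
by move/eqP; rewrite scaler_eq0 (negPf e0) => /eqP.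
Qed.

(** Gram-Schmidt: as long as fewer than [\rank A] rows are chosen, some row of [A] lies outside
    their span, and its normalised residue is added. *)
Lemma real_orthonormal_basis p k (A : 'M[R]_(p, k)) :
  exists O : 'M[R]_(\rank A, k), O *m O^T = 1%:M /\ (O :=: A)%MS.
Proof.
suff h j : (j <= \rank A)%N -> exists O : 'M[R]_(j, k), O *m O^T = 1%:M /\ (O <= A)%MS.
  have [O [OO OA]] := h _ (leqnn _); exists O; split=> //; apply/eqmxP.
  (* Orthonormal rows have full rank, so the inclusion is an equality of row spaces. *)
  rewrite -(geq_leqif (mxrank_leqif_eq OA)).
  by rewrite -{1}(mxrank1 R (\rank A)) -OO mxrankM_maxl.
elim: j => [_|j IH hj]; first by exists 0; split; [rewrite mul0mx; apply/matrixP=> -[] | apply: sub0mx].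
have [O [OO OA]] := IH (ltnW hj).
have /row_subPn[x hx] : ~~ (A <= O)%MS.
  apply: contraL hj => /mxrankS h; rewrite -leqNgt.
  by apply: leq_trans h (rank_leq_row O).
pose w := row x A - row x A *m O^T *m O.
have wO : w *m O^T = 0 by rewrite mulmxBl -(mulmxA (row x A *m O^T)) OO mulmx1 subrr.
have w0 : w != 0.
  by apply: contra hx; rewrite subr_eq0 => /eqP->; apply: submxMl.
have wA : (w <= A)%MS.
  rewrite addmx_sub ?row_sub // eqmx_opp; apply: submx_trans OA; apply: submxMl.
have c0 : 0 < (w *m w^T) 0 0.
  by have := @gram_col_gt0 _ _ w^T; rewrite trmxK; apply; rewrite -trmx0 (inj_eq trmx_inj).
pose c := Num.sqrt ((w *m w^T) 0 0).
have cp : 0 < c by rewrite sqrtr_gt0.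
have cc : w *m w^T = (c * c)%:M.
  by rewrite -expr2 sqr_sqrtr ?(ltW c0) // [LHS]mx11_scalar.
change (exists O : 'M[R]_(1 + j, k), O *m O^T = 1%:M /\ (O <= A)%MS).
exists (col_mx (c^-1 *: w) O); split; last first.
  by rewrite col_mx_sub OA andbT scalemx_sub.
rewrite tr_col_mx mul_col_row linearZ /= -!scalemxAr -!scalemxAl wO OO cc.
have -> : O *m w^T = 0 by apply: trmx_inj; rewrite trmx_mul trmxK wO trmx0.
rewrite !scaler0 scalerA scale_scalar_mx.
have -> : c^-1 / c * (c * c) = 1 by field; rewrite gt_eqF.
by rewrite -scalar_mx_block.
Qed.

End Extreme.

(** * Complex matrices as real vectors under the Hilbert-Schmidt inner product *)

Section RealVector.
Variable R : realType.
Local Notation C := R[i].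
Local Open Scope complex_scope.

Definition real_vec p q (Z : 'M[C]_(p, q)) : 'rV[R]_(p * q + p * q) :=
  row_mx (mxvec (map_mx (@complex.Re R) Z)) (mxvec (map_mx (@complex.Im R) Z)).

Lemma mxvec_dot p q (Z W : 'M[R]_(p, q)) :
  (mxvec Z *m (mxvec W)^T) 0 0 = \sum_i \sum_j Z i j * W i j.
Proof.
rewrite mxE (reindex _ (curry_mxvec_bij p q)) pair_bigA /=.
by apply: eq_bigr => -[i j] _; rewrite mxE !mxvecE.
Qed.

Lemma real_vec_dot p q (Z W : 'M[C]_(p, q)) :
  (real_vec Z *m (real_vec W)^T) 0 0 = complex.Re (\tr (Z *m adjmx W)).
Proof.
rewrite tr_row_mx mul_row_col mxE !mxvec_dot -big_split /= Re_sum; apply: eq_bigr => i _.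
rewrite mxE Re_sum -big_split; apply: eq_bigr => j _.
by rewrite !mxE [X in _ = complex.Re X]mulrC Re_conjM; congr (_ + _); rewrite mulrC.
Qed.

Lemma Im_add (a b : C) : complex.Im (a + b) = complex.Im a + complex.Im b.
Proof. by case: a => ? ?; case: b. Qed.

Lemma Re_realM (r : R) (a : C) : complex.Re (r%:C * a) = r * complex.Re a.
Proof. by case: a => ? ? /=; rewrite mul0r subr0. Qed.

Lemma Im_realM (r : R) (a : C) : complex.Im (r%:C * a) = r * complex.Im a.
Proof. by case: a => ? ? /=; rewrite mul0r addr0. Qed.

Lemma real_vecD p q (Z W : 'M[C]_(p, q)) : real_vec (Z + W) = real_vec Z + real_vec W.
Proof.
rewrite /real_vec add_row_mx -!linearD; congr row_mx; congr mxvec.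
  by apply/matrixP=> i j; rewrite !mxE Re_add.
by apply/matrixP=> i j; rewrite !mxE Im_add.
Qed.

Lemma real_vecZ p q (r : R) (Z : 'M[C]_(p, q)) : real_vec (r%:C *: Z) = r *: real_vec Z.
Proof.
rewrite /real_vec scale_row_mx -!linearZ; congr row_mx; congr mxvec.
  by apply/matrixP=> i j; rewrite !mxE Re_realM.
by apply/matrixP=> i j; rewrite !mxE Im_realM.
Qed.

Lemma real_vec0 p q : real_vec (0 : 'M[C]_(p, q)) = 0.
Proof. by rewrite -[0 in LHS](scale0r 0) -(rmorph0 (real_complex R)) real_vecZ scale0r. Qed.

Lemma real_vec_sum p q I (r : seq I) (P : pred I) (f : I -> 'M[C]_(p, q)) :
  real_vec (\sum_(i <- r | P i) f i) = \sum_(i <- r | P i) real_vec (f i).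
Proof. exact: (big_morph _ (@real_vecD p q) (real_vec0 p q)). Qed.

Lemma real_vec_inj p q : injective (@real_vec p q).
Proof.
move=> Z W /eq_row_mx[/(can_inj mxvecK) e1 /(can_inj mxvecK) e2].
apply/matrixP=> i j; have := congr1 (fun M : 'M_(p, q) => M i j) e1.
have := congr1 (fun M : 'M_(p, q) => M i j) e2; rewrite !mxE.
by case: (Z i j) => ? ?; case: (W i j) => ? ? /= -> ->.
Qed.

End RealVector.

(** * Commuting observables extracted from a representation *)

Section Representation.
Variable R : realType.
Local Notation C := R[i].
Local Open Scope complex_scope.

Lemma trace_adj_ge0 p q (Z : 'M[C]_(p, q)) : 0 <= complex.Re (\tr (Z *m adjmx Z)).
Proof. by rewrite -real_vec_dot gram_ge0. Qed.

Lemma trace_adj_eq0 p q (Z : 'M[C]_(p, q)) : complex.Re (\tr (Z *m adjmx Z)) = 0 -> Z = 0.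
Proof.
rewrite -real_vec_dot => /gram_row_eq0; rewrite row_id => h.
by apply: real_vec_inj; rewrite h real_vec0.
Qed.

Lemma psd_tens1r p q (P : 'M[C]_p) : psd P -> psd (P *t (1%:M : 'M[C]_q)).
Proof.
case/psd_factor=> Q ->; have -> : (adjmx Q *m Q) *t (1%:M : 'M_q) = adjmx (Q *t 1%:M) *m (Q *t 1%:M).
  by rewrite adjmx_tens tensmx_mul adjmx1 mulmx1.
exact: psd_adjM.
Qed.

Lemma psd_tens1l p q (P : 'M[C]_q) : psd P -> psd ((1%:M : 'M[C]_p) *t P).
Proof.
case/psd_factor=> Q ->; have -> : (1%:M : 'M_p) *t (adjmx Q *m Q) = adjmx (1%:M *t Q) *m (1%:M *t Q).
  by rewrite adjmx_tens tensmx_mul adjmx1 mulmx1.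
exact: psd_adjM.
Qed.

(* [1 - (P - Q)^2 = 4 P Q = 4 (P Q P + Q P Q)], a sum of psd terms. *)
Lemma sharp_contraction p q (P Q : 'M[C]_q) (S : 'M[C]_(p, q)) :
  psd P -> psd Q -> P + Q = 1%:M ->
  complex.Re (\tr (S *m adjmx S)) = 1 ->
  complex.Re (\tr (S *m (P - Q) *m adjmx (S *m (P - Q)))) <= 1 /\
  (complex.Re (\tr (S *m (P - Q) *m adjmx (S *m (P - Q)))) = 1 ->
   S *m (P - Q) *m (P - Q) = S).
Proof.
have ar (t a b : R) : 0 <= a -> 0 <= b -> t = 1 - 4 * (a + b) -> t <= 1 /\ (t = 1 -> a = 0).
  by move=> *; split; lra.
move=> pP pQ PQ1 S1; have hP := psd_herm pP; have hQ := psd_herm pQ.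
have [K eK] := psd_factor pQ; have [L eL] := psd_factor pP.
have PQ : P *m Q = Q *m P.
  have -> : Q = 1%:M - P by rewrite -PQ1 addrC addKr.
  by rewrite mulmxBr mulmxBl mulmx1 mul1mx.
have sq : (P - Q) *m (P - Q) = 1%:M - 4%:R *: (P *m Q).
  have : (P + Q) *m (P + Q) = 1%:M by rewrite PQ1 mulmx1.
  rewrite !(mulmxDl, mulmxDr, mulmxN, mulNmx) -PQ opprK => <-.
  rewrite scaler_nat; move: (P *m P) (P *m Q) (Q *m Q) => a b c.
  by apply/matrixP=> i j; rewrite !mxE; ring.
have PQe : P *m Q = P *m adjmx K *m (K *m P) + Q *m adjmx L *m (L *m Q).
  rewrite !mulmxA -(mulmxA P (adjmx K)) -eK -(mulmxA Q (adjmx L)) -eL.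
  have -> : P *m Q *m P = P *m (P *m Q) by rewrite -mulmxA -PQ.
  by rewrite -(mulmxA Q) -mulmxDl PQ1 mul1mx.
have tr1 : complex.Re (\tr (S *m (P - Q) *m adjmx (S *m (P - Q)))) =
   1 - 4 * (complex.Re (\tr (S *m P *m adjmx K *m adjmx (S *m P *m adjmx K))) +
        complex.Re (\tr (S *m Q *m adjmx L *m adjmx (S *m Q *m adjmx L)))).
  have -> : S *m (P - Q) *m adjmx (S *m (P - Q)) = S *m adjmx S - (4%:R)%:C *:
      (S *m P *m adjmx K *m adjmx (S *m P *m adjmx K) +
       S *m Q *m adjmx L *m adjmx (S *m Q *m adjmx L)).
    rewrite !adjmxM !adjmxK adjmxB hP hQ.
    rewrite !mulmxA -(mulmxA S (P - Q)) sq PQe rmorph_nat.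
    rewrite mulmxBr mulmx1 mulmxBl -scalemxAr -scalemxAl mulmxDr mulmxDl.
    by rewrite !mulmxA.
  have ReN (a : C) : complex.Re (- a) = - complex.Re a by case: a.
  by rewrite mxtraceD (linearN mxtrace) /= mxtraceZ Re_add ReN Re_realM mxtraceD Re_add S1.
have g1 := trace_adj_ge0 (S *m P *m adjmx K); have g2 := trace_adj_ge0 (S *m Q *m adjmx L).
(* Equality forces [S P adjmx K = 0], hence [S P Q = 0] since [Q = adjmx K *m K], and [(P - Q)^2]
   fixes [S]. *)
have [le1 eq1] := ar _ _ _ g1 g2 tr1; split=> // /eq1/trace_adj_eq0 z1.
rewrite -mulmxA sq mulmxBr mulmx1 -scalemxAr mulmxA eK mulmxA z1 mul0mx scaler0 subr0 //.
Qed.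

Lemma Re_diff4 (a b c d : R) (ta tb tc td : C) :
  a%:C = ta -> b%:C = tb -> c%:C = tc -> d%:C = td ->
  complex.Re (ta - tb - (tc - td)) = a - b - (c - d).
Proof. by move=> <- <- <- <-. Qed.

(** [A x] and [B y] are the differences of the two effects, acting on the first and second tensor
    factor, and [adjmx S *m S] is the state. The last two clauses come from [sharp_contraction]: at
    unit norm, the observable squares to the identity on [S]. *)
Lemma has_rep_operators n m (Cm : 'M[R]_(n, m)) d : has_rep (pC Cm) d ->
  exists (A : 'I_n -> 'M[C]_(d * d)) (B : 'I_m -> 'M[C]_(d * d)) (S : 'M[C]_(d * d)),
  [/\ forall x y, A x *m B y = B y *m A x,
      complex.Re (\tr (S *m adjmx S)) = 1,
      forall x y, complex.Re (\tr (S *m A x *m adjmx (S *m B y))) = Cm x y,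
      forall x, complex.Re (\tr (S *m A x *m adjmx (S *m A x))) <= 1 /\
       (complex.Re (\tr (S *m A x *m adjmx (S *m A x))) = 1 -> S *m A x *m A x = S)
    & forall y, complex.Re (\tr (S *m B y *m adjmx (S *m B y))) <= 1 /\
       (complex.Re (\tr (S *m B y *m adjmx (S *m B y))) = 1 -> S *m B y *m B y = S)].
Proof.
case=> rho [MA [NB [[prho trho] [pA [sA [pB [sB hp]]]]]]].
have [S eS] := psd_factor prho.
have S1 : complex.Re (\tr (S *m adjmx S)) = 1 by rewrite mxtrace_mulC -eS trho.
pose i0 : 'I_2 := ord0; pose i1 : 'I_2 := lift ord0 ord0.
exists (fun x => MA x i0 *t 1%:M - MA x i1 *t 1%:M),
  (fun y => 1%:M *t NB y i0 - 1%:M *t NB y i1), S.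
have sA' x : MA x i0 + MA x i1 = 1%:M by rewrite -(sA x) big_ord_recl big_ord1.
have sB' y : NB y i0 + NB y i1 = 1%:M by rewrite -(sB y) big_ord_recl big_ord1.
have eA x : MA x i0 *t 1%:M - MA x i1 *t 1%:M = (MA x i0 - MA x i1) *t (1%:M : 'M[C]_d).
  by rewrite tensmxDl tensmxNl.
have eB y : 1%:M *t NB y i0 - 1%:M *t NB y i1 = (1%:M : 'M[C]_d) *t (NB y i0 - NB y i1).
  by rewrite tensmxDr tensmxNr.
split=> // [x y|x y|x|y].
- by rewrite eA eB !tensmx_mul !mulmx1 !mul1mx.
- rewrite eA eB adjmxM adjmx_tens adjmx1 adjmxB (psd_herm (pB y i0)) (psd_herm (pB y i1)).
  rewrite mulmxA mxtrace_mulC !mulmxA -eS -mulmxA tensmx_mul mulmx1 mul1mx mxtrace_mulC.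
  rewrite mxtrace_tens_diff.
  apply: etrans (Re_diff4 (hp i0 i0 x y) (hp i0 i1 x y) (hp i1 i0 x y) (hp i1 i1 x y)) _.
  by rewrite /= /pC /sgn2 /=; field.
- apply: sharp_contraction => //; [exact: psd_tens1r | exact: psd_tens1r |].
  by rewrite -tensmxDl sA' tensmx11.
- apply: sharp_contraction => //; [exact: psd_tens1l | exact: psd_tens1l |].
  by rewrite -tensmxDr sB' tensmx11.
Qed.

End Representation.

(** * Clifford relations on one vector spread over a module of the commutant *)

Section CyclicModule.
Variable F : fieldType.

(** The rows of [E] are vectorised matrices. When they span an algebra, this row space is the right
    module generated by the rows of [S]. *)
Definition cyclic_mx p q N (S : 'M[F]_(p, N)) (E : 'M[F]_(q, N * N)) : 'M[F]_N :=
  (\sum_(i < q) <<S *m vec_mx (row i E)>>)%MS.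

Lemma cyclic_mx_mem p q N (S : 'M[F]_(p, N)) (E : 'M[F]_(q, N * N)) B :
  (mxvec B <= E)%MS -> (S *m B <= cyclic_mx S E)%MS.
Proof.
case/submxP=> D eB; rewrite -[B]mxvecK eB mulmx_sum_row linear_sum mulmx_sumr.
apply: summx_sub => i _; rewrite linearZ /= -scalemxAr scalemx_sub //.
by apply: (sumsmx_sup i) => //; rewrite genmxE.
Qed.

Lemma cyclic_mx_eq p q N (S : 'M[F]_(p, N)) (E : 'M[F]_(q, N * N)) (X Y : 'M[F]_N) :
  (forall B, (mxvec B <= E)%MS -> S *m B *m X = S *m B *m Y) ->
  cyclic_mx S E *m X = cyclic_mx S E *m Y.
Proof.
move=> h; have /sub_sumsmxP[u ->] := submx_refl (cyclic_mx S E).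
rewrite !mulmx_suml; apply: eq_bigr => i _.
have /submxP[D ->] : (u i *m <<S *m vec_mx (row i E)>> <= S *m vec_mx (row i E))%MS.
  by apply: submx_trans (submxMl _ _) _; rewrite genmxE.
by rewrite -!(mulmxA D) h // vec_mxK row_sub.
Qed.

Lemma cyclic_mx_stable p q N (S : 'M[F]_(p, N)) (E : 'M[F]_(q, N * N)) r (W : 'M[F]_(r, N)) X :
  (forall B, (mxvec B <= E)%MS -> (S *m B *m X <= W)%MS) ->
  (cyclic_mx S E *m X <= W)%MS.
Proof.
move=> h; rewrite sumsmxMr; apply/sumsmx_subP => i _.
by rewrite (eqmxMr _ (genmxE _)) h // vec_mxK row_sub.
Qed.

(* [K = S * commutant of the G_i] is a module over the Clifford algebra although
   the relations are only assumed to hold on [S]: each [S G_i] is also [S H_i]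
   with [H_i] in the commutant. *)
Lemma clifford_vector_dim (im : F) k p N n (A : 'I_n -> 'M[F]_N) (S : 'M[F]_(p, N))
    (G H : nat -> 'M[F]_N) :
  im * im = -1 -> 2 != 0 :> F -> S != 0 ->
  (forall i B, (forall x, A x *m B = B *m A x) -> G i *m B = B *m G i) ->
  (forall i x, (i < k.*2)%N -> A x *m H i = H i *m A x) ->
  (forall i, (i < k.*2)%N -> S *m G i = S *m H i) ->
  (forall i j, (i < k.*2)%N -> (j < k.*2)%N ->
     S *m (G i *m G j + G j *m G i) = (2 * (i == j)%:R) *: S) ->
  (2 ^ k <= N)%N.
Proof.
move=> im2 two0 S0 GC AH SGH rel.
pose E := cent_mx (\matrix_(x < n) mxvec (A x)).
have memE B : (mxvec B <= E)%MS <-> (forall x, A x *m B = B *m A x).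
  split=> [/cent_rowP h x|h]; first by have := h x; rewrite rowK mxvecK.
  by apply/cent_rowP => x; rewrite rowK mxvecK.
have hrel i j B : (i < k.*2)%N -> (j < k.*2)%N -> (mxvec B <= E)%MS ->
    S *m B *m (G i *m G j + G j *m G i) = (2 * (i == j)%:R) *: (S *m B).
  move=> hi hj /memE hB.
  (* By [GC] each [G i] commutes with [B], so the relation on [S] carries over to [S *m B]. *)
  have -> : S *m B *m (G i *m G j + G j *m G i) = S *m (G i *m G j + G j *m G i) *m B.
    rewrite -!mulmxA; congr (_ *m _); rewrite mulmxDr mulmxDl !mulmxA.
    by rewrite -(GC i B) // -(GC j B) // -!mulmxA -(GC i B) // -(GC j B).
  by rewrite rel // -scalemxAl.
have K0 : cyclic_mx S E != 0.
  apply: contra S0 => /eqP K0; rewrite -submx0 -K0 -{1}[S]mulmx1.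
  by apply: cyclic_mx_mem; apply/memE => x; rewrite mulmx1 mul1mx.
apply: leq_trans (rank_leq_row (cyclic_mx S E)).
apply: (clifford_module_dim im2 two0 (G := G)) => // [i hi|i hi|i j hi hj ij].
- apply: cyclic_mx_stable => B /memE hB.
  have -> : S *m B *m G i = S *m (H i *m B) by rewrite -mulmxA -(GC i B hB) !mulmxA SGH.
  by apply: cyclic_mx_mem; apply/memE => x; rewrite mulmxA AH // -!mulmxA hB.
- apply: cyclic_mx_eq => B hB; rewrite mulmx1; apply: (scalerI two0).
  have := hrel i i B hi hi hB; rewrite eqxx mulr1 => <-.
  by rewrite -mulr2n -(scaler_nat 2 (G i *m G i)) -scalemxAr.
- apply: cyclic_mx_eq => B hB; apply/eqP; rewrite mulmxN -addr_eq0 -mulmxDr.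
  by rewrite hrel // (negPf ij) mulr0 scale0r.
Qed.

End CyclicModule.

(** * Gram vectors from a representation and Lorentz-cone vectors from Gram vectors *)

Section GramLorentz.
Variable R : realType.
Local Notation C := R[i].

Lemma has_rep_gram n m (Cm : 'M[R]_(n, m)) d : has_rep (pC Cm) d -> vec_corr Cm.
Proof.
case/has_rep_operators=> A [B [S [_ _ hc hA hB]]].
exists (d * d * (d * d) + d * d * (d * d))%N,
  (\matrix_x real_vec (S *m A x)), (\matrix_y real_vec (S *m B y)).
have E p q k (u : 'I_p -> 'rV[R]_k) (v : 'I_q -> 'rV[R]_k) x y :
    (\matrix_x u x *m (\matrix_y v y)^T) x y = (u x *m (v y)^T) 0 0.
  by rewrite !mxE; apply: eq_bigr => i _; rewrite !mxE.
split=> [x|y|]; first by rewrite E real_vec_dot; case: (hA x).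
  by rewrite E real_vec_dot; case: (hB y).
by apply/matrixP=> x y; rewrite E real_vec_dot hc.
Qed.

Lemma vec_corr_gram_lorentz n m (Cm : 'M[R]_(n, m)) : vec_corr Cm ->
  exists Rm, inA (pC Cm) Rm /\ gram_lorentz Rm.
Proof.
case=> k [u [v [hu hv ->]]].
(* With the factor one half, the two vectors of each setting add up to the unit vector [(1, 0)], so
   every block of [Rm] sums to 1. *)
pose w (s : idx n m 2 2) : 'rV[R]_k.+1 :=
  match s with
  | inl (x, a) => row_mx (2^-1)%:M ((sgn2 R a / 2) *: row x u)
  | inr (y, b) => row_mx (2^-1)%:M ((sgn2 R b / 2) *: row y v)
  end.
pose Rm s t := (w s *m (w t)^T) 0 0.
have sq a : (sgn2 R a / 2) ^+ 2 = 4^-1.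
  by rewrite /sgn2; case: ifP => _; field.
have dot p q (a b : 'I_2) (f : 'M[R]_(p, k)) (g : 'M[R]_(q, k)) x y :
   ((row_mx (2^-1)%:M ((sgn2 R a / 2) *: row x f) : 'rV[R]_k.+1) *m
     (row_mx (2^-1)%:M ((sgn2 R b / 2) *: row y g) : 'rV[R]_k.+1)^T) 0 0 =
   (1 + sgn2 R a * sgn2 R b * (f *m g^T) x y) / 4.
  have -> : (f *m g^T) x y = (row x f *m (row y g)^T) 0 0.
    by rewrite !mxE; apply: eq_bigr => i _; rewrite !mxE.
  rewrite (tr_row_mx (2^-1)%:M) (mul_row_col (2^-1)%:M) tr_scalar_mx -scalar_mxM.
  rewrite linearZ /= -scalemxAr -scalemxAl scalerA mxE [X in X + _]mxE eqxx mulr1n [X in _ + X]mxE.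
  by move: ((_ *m _) 0 0) => c; field.
have cone p (a : 'I_2) (f : 'M[R]_(p, k)) x : (f *m f^T) x x <= 1 ->
    in_lorentz (row_mx (2^-1)%:M ((sgn2 R a / 2) *: row x f) : 'rV[R]_k.+1).
  move=> hf; rewrite /in_lorentz.
  have -> : (row_mx (2^-1)%:M ((sgn2 R a / 2) *: row x f) : 'rV[R]_k.+1) ord0 ord0 = 2^-1.
    have -> : ord0 = lshift k (ord0 : 'I_1) by apply: val_inj.
    by rewrite (row_mxEl (2^-1)%:M) mxE eqxx.
  rewrite (eq_bigr (fun i => 4^-1 * f x i ^+ 2)); last first.
    move=> i _; have -> : lift ord0 i = rshift 1 i by apply: val_inj.
    by rewrite (row_mxEr (2^-1)%:M) !mxE exprMn sq.
  rewrite -mulr_sumr -gram_rowE.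
  have -> : 2^-1 = Num.sqrt 4^-1 :> R.
    have -> : 4^-1 = (2^-1) ^+ 2 :> R by field.
    by rewrite sqrtr_sqr ger0_norm // invr_ge0 ler0n.
  by rewrite ler_wsqrtr //; lra.
exists Rm; split; last first.
  exists k, w; split=> [[[x a]|[y b]]|s t]; [exact: cone | exact: cone |].
  by rewrite /Rm mxE; apply: eq_bigr => i _; rewrite mxE.
split; [|split; [|split; [|split]]] => [s t|x x'|x y|y y'|x a y b].
- by rewrite /Rm -[in LHS](trmxK (w s)) -trmx_mul mxE.
- by rewrite !big_ord_recl !big_ord0 /Rm /w !dot /sgn2 /=; field.
- by rewrite !big_ord_recl !big_ord0 /Rm /w !dot /sgn2 /=; field.
- by rewrite !big_ord_recl !big_ord0 /Rm /w !dot /sgn2 /=; field.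
by rewrite /Rm /w dot.
Qed.

End GramLorentz.

(** * Clifford relations from extremality, and the resulting dimension bound *)

Section DimensionBound.
Variable R : realType.
Local Notation C := R[i].
Local Open Scope complex_scope.

Definition real_comb p N (g : 'rV[R]_p) (A : 'I_p -> 'M[C]_N) : 'M[C]_N :=
  \sum_i (g 0 i)%:C *: A i.

Lemma real_comb_comm p N (g : 'rV[R]_p) (A : 'I_p -> 'M[C]_N) B :
  (forall i, A i *m B = B *m A i) -> real_comb g A *m B = B *m real_comb g A.
Proof.
move=> h; rewrite mulmx_suml mulmx_sumr; apply: eq_bigr => i _.
by rewrite -scalemxAl -scalemxAr h.
Qed.

Lemma real_vec_mul_comb p N (g : 'rV[R]_p) (A : 'I_p -> 'M[C]_N) (S : 'M[C]_N)
    (u : 'M[R]_(p, N * N + N * N)) :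
  (forall i, row i u = real_vec (S *m A i)) ->
  real_vec (S *m real_comb g A) = g *m u.
Proof.
move=> h; rewrite mulmx_sumr real_vec_sum mulmx_sum_row; apply: eq_bigr => i _.
by rewrite -scalemxAr real_vecZ h.
Qed.

Definition clifford_defect p N (S : 'M[C]_N) (G : 'I_p -> 'M[C]_N) i j : 'M[C]_N :=
  S *m (G i *m G j + G j *m G i) - (2 * (i == j)%:R)%:C *: S.

(** With [G(g)] the combination [real_comb g G], the double sum is [2 (S G(g)^2 - |g|^2 S)]. *)
Lemma clifford_defect_quad p N (S : 'M[C]_N) (G : 'I_p -> 'M[C]_N) (g : 'rV[R]_p) :
  S *m real_comb g G *m real_comb g G = S -> (g *m g^T) 0 0 = 1 ->
  \sum_i \sum_j (g 0 i * g 0 j)%:C *: clifford_defect S G i j = 0.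
Proof.
move=> gG g1.
have e1 : \sum_i \sum_j (g 0 i * g 0 j)%:C *: (S *m (G i *m G j)) = S.
  have mul_comb (Z : 'M[C]_N) : Z *m real_comb g G = \sum_i (g 0 i)%:C *: (Z *m G i).
    by rewrite mulmx_sumr; apply: eq_bigr => i _; rewrite -scalemxAr.
  rewrite -[RHS]gG (mul_comb S) mulmx_suml; apply: eq_bigr => i _.
  rewrite mul_comb; apply: eq_bigr => j _.
  by rewrite -scalemxAl scalerA rmorphM mulrC mulmxA.
have e2 : \sum_i \sum_j (g 0 i * g 0 j)%:C *: (S *m (G j *m G i)) = S.
  apply: etrans e1; rewrite exchange_big; apply: eq_bigr => i _; apply: eq_bigr => j _.
  by rewrite mulrC.
have e3 : \sum_i \sum_j (g 0 i * g 0 j)%:C *: ((2 * (i == j)%:R)%:C *: S) = S + S.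
  have -> : S + S = (2 * (g *m g^T) 0 0)%:C *: S.
    by rewrite g1 mulr1 rmorph_nat scaler_nat.
  rewrite mxE mulr_sumr rmorph_sum scaler_suml; apply: eq_bigr => i _.
  rewrite (bigD1 i) //= big1 ?addr0 => [|j ji].
    by rewrite eqxx mulr1 scalerA -rmorphM mxE mulrC.
  by rewrite eq_sym (negPf ji) mulr0 rmorph0 scale0r scaler0.
transitivity (\sum_i \sum_j (g 0 i * g 0 j)%:C *: (S *m (G i *m G j)) +
  \sum_i \sum_j (g 0 i * g 0 j)%:C *: (S *m (G j *m G i)) -
  \sum_i \sum_j (g 0 i * g 0 j)%:C *: ((2 * (i == j)%:R)%:C *: S)); last first.
  by rewrite (congr2 +%R e1 e2) e3 subrr.
rewrite -big_split -sumrB; apply: eq_bigr => i _; rewrite -big_split -sumrB; apply: eq_bigr => j _.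
by rewrite /clifford_defect scalerBr mulmxDr scalerDr.
Qed.

(** Real and imaginary parts are such functionals. They turn the complex defects into real symmetric
    forms, to which [mid_extreme_sym] applies. *)
Lemma entry_functional_zero p N (Z : 'M[C]_(p, N)) :
  (forall (f : C -> R), (forall a b, f (a + b) = f a + f b) ->
     (forall r a, f (r%:C * a) = r * f a) -> forall i j, f (Z i j) = 0) -> Z = 0.
Proof.
move=> h; apply/matrixP=> i j; rewrite mxE.
have := h _ (@Re_add R) (@Re_realM R) i j; have := h _ (@Im_add R) (@Im_realM R) i j.
by case: (Z i j) => a b /= -> ->.
Qed.

(** A real functional of one entry of the defects is a symmetric form in the coordinates of the
    basis [O]. It vanishes at the coordinates [xi] and [eta] of the [u_x] and [v_y], so extremality
    kills its mixed values on [u] and [v]; both families span [O], and the form is zero. *)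
Lemma clifford_relations n m k r N (u : 'M[R]_(n, k)) (v : 'M[R]_(m, k))
    (O : 'M[R]_(r, k)) (S : 'M[C]_N) (G : 'I_r -> 'M[C]_N) xi eta al be i j :
  mid_extreme (u *m v^T) ->
  (forall x, (u *m u^T) x x = 1) -> (forall y, (v *m v^T) y y = 1) ->
  O *m O^T = 1%:M -> u = xi *m O -> v = eta *m O -> O = al *m u -> O = be *m v ->
  (forall x, S *m real_comb (row x xi) G *m real_comb (row x xi) G = S) ->
  (forall y, S *m real_comb (row y eta) G *m real_comb (row y eta) G = S) ->
  S *m (G i *m G j + G j *m G i) = (2 * (i == j)%:R) *: S.
Proof.
move=> ext hu hv OO eu ev eOu eOv Gu Gv.
have conj0 p (w : 'M[R]_(p, k)) om (X : 'M[R]_k) (Y : 'M[R]_r) : w = om *m O ->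
    X = O^T *m Y *m O -> w *m X *m w^T = om *m Y *m om^T.
  move=> -> ->; rewrite trmx_mul !mulmxA -(mulmxA om) OO mulmx1.
  by rewrite -(mulmxA (om *m Y)) OO mulmx1.
have nrm p (w : 'M[R]_(p, k)) om : w = om *m O -> w *m w^T = om *m om^T.
  by move=> ->; rewrite trmx_mul mulmxA -(mulmxA om) OO mulmx1.
have rown p (om : 'M[R]_(p, r)) x : (row x om *m (row x om)^T) 0 0 = (om *m om^T) x x.
  by rewrite !mxE; apply: eq_bigr => l _; rewrite !mxE.
suff T0 : clifford_defect S G i j = 0.
  move/eqP: T0; rewrite subr_eq0 => /eqP ->.
  by rewrite rmorphM !rmorph_nat.
apply: entry_functional_zero => f fD fZ a b.
have f0 : f 0 = 0 by rewrite -(mul0r 0) -(rmorph0 (real_complex R)) fZ mul0r.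
have fS I (s : seq I) (P : pred I) (F : I -> C) :
  f (\sum_(l <- s | P l) F l) = \sum_(l <- s | P l) f (F l) by exact: (big_morph f fD f0).
pose Y : 'M[R]_r := \matrix_(i, j) f (clifford_defect S G i j a b).
have symY : Y^T = Y.
  apply/matrixP=> i' j'; rewrite !mxE /clifford_defect eq_sym.
  by rewrite [G j' *m _ + _]addrC.
have quadY p (om : 'M[R]_(p, r)) x :
    S *m real_comb (row x om) G *m real_comb (row x om) G = S -> (om *m om^T) x x = 1 ->
    (om *m Y *m om^T) x x = 0.
  move=> h1 h2; have := clifford_defect_quad h1; rewrite rown => /(_ h2).
  move/(congr1 (fun M : 'M[C]_N => f (M a b))); rewrite [in RHS]mxE f0 => <-.
  rewrite summxE fS mxE (eq_bigr (fun j' => \sum_i' om x i' * om x j' * Y i' j')); last first.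
    by move=> j' _; rewrite !mxE mulr_suml; apply: eq_bigr => i' _; rewrite mulrAC.
  rewrite exchange_big; apply: eq_bigr => i' _; rewrite summxE fS; apply: eq_bigr => j' _.
  by rewrite [Y i' j']mxE !mxE fZ.
(* The form [Y] transported from coordinates to the ambient space. *)
pose X := O^T *m Y *m O.
have symX : X^T = X by rewrite /X !trmx_mul trmxK symY mulmxA.
have := mid_extreme_sym ext _ _ symX _ _.
have leu x : (u *m u^T) x x <= 1 by rewrite hu.
have lev y : (v *m v^T) y y <= 1 by rewrite hv.
move/(_ leu lev) => h0.
have {}h0 : u *m X *m v^T = 0.
  apply: h0 => [x|y].
    by rewrite (conj0 _ _ _ _ _ eu erefl); apply: quadY; rewrite // -(nrm _ _ _ eu).
  by rewrite (conj0 _ _ _ _ _ ev erefl); apply: quadY; rewrite // -(nrm _ _ _ ev).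
have Y0 : Y = 0.
  have := conj0 _ O 1%:M X Y; rewrite !mul1mx trmx1 mulmx1 => <- //.
  have -> : O *m X *m O^T = al *m (u *m X *m v^T) *m be^T.
    by rewrite !mulmxA -eOu -(mulmxA _ v^T) -trmx_mul -eOv.
  by rewrite h0 mulmx0 mul0mx.
by have := congr1 (fun M : 'M_r => M i j) Y0; rewrite !mxE.
Qed.

Lemma extreme_rep_dim n m (Cm : 'M[R]_(n, m)) d :
  mid_extreme Cm -> Cm != 0 -> has_rep (pC Cm) d ->
  (2 ^ (\rank Cm)./2 <= d * d)%N.
Proof.
move=> ext C0 /has_rep_operators[A [B [S [AB S1 hc hA hB]]]].
set N := (d * d)%N in A B S AB S1 hc hA hB *.
pose u : 'M[R]_(n, N * N + N * N) := \matrix_x real_vec (S *m A x).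
pose v : 'M[R]_(m, N * N + N * N) := \matrix_y real_vec (S *m B y).
have ru x : row x u = real_vec (S *m A x) by rewrite rowK.
have rv y : row y v = real_vec (S *m B y) by rewrite rowK.
have E p q k (w : 'M[R]_(p, k)) (z : 'M[R]_(q, k)) x y :
    (w *m z^T) x y = (row x w *m (row y z)^T) 0 0.
  by rewrite !mxE; apply: eq_bigr => i _; rewrite !mxE.
have eC : Cm = u *m v^T.
  by apply/matrixP=> x y; rewrite E ru rv real_vec_dot hc.
have leu x : (u *m u^T) x x <= 1 by rewrite E ru real_vec_dot; case: (hA x).
have lev y : (v *m v^T) y y <= 1 by rewrite E rv real_vec_dot; case: (hB y).
clearbody u v; rewrite eC in ext C0 *.
have u0 : u != 0 by apply: contra C0 => /eqP->; rewrite mul0mx.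
have v0 : v != 0 by apply: contra C0 => /eqP->; rewrite trmx0 mulmx0.
have ext' : mid_extreme (v *m u^T) by have := mid_extreme_tr ext; rewrite trmx_mul trmxK.
have u1 x : (u *m u^T) x x = 1 := mid_extreme_norm x ext leu lev v0.
have v1 y : (v *m v^T) y y = 1 := mid_extreme_norm y ext' lev leu u0.
have uv := mid_extreme_span ext leu lev v0.
have vu := mid_extreme_span ext' lev leu u0.
have SAA x : S *m A x *m A x = S.
  by case: (hA x) => _; apply; rewrite -real_vec_dot -ru -E.
have SBB y : S *m B y *m B y = S.
  by case: (hB y) => _; apply; rewrite -real_vec_dot -rv -E.
have [O [OO OU]] := real_orthonormal_basis u.
have /submxP[al eOu] : (O <= u)%MS by rewrite OU.
have /submxP[be eOv] : (O <= v)%MS by rewrite OU.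
have /submxP[xi eu] : (u <= O)%MS by rewrite OU.
have /submxP[eta ev] : (v <= O)%MS by rewrite OU.
(* [S *m G i] and [S *m H i] both represent the [i]-th basis vector, while [H i] commutes with every
   [A x]. *)
pose G i := real_comb (row i al) A; pose H i := real_comb (row i be) B.
have rG i : row i O = real_vec (S *m G i).
  by rewrite (real_vec_mul_comb _ ru) -row_mul -eOu.
have rH i : row i O = real_vec (S *m H i).
  by rewrite (real_vec_mul_comb _ rv) -row_mul -eOv.
have SGH i : S *m G i = S *m H i by apply: real_vec_inj; rewrite -rG -rH.
have xiG x : S *m real_comb (row x xi) G = S *m A x.
  by apply: real_vec_inj; rewrite (real_vec_mul_comb _ rG) -row_mul -eu ru.
have xiH x : S *m real_comb (row x xi) H = S *m A x.
  by apply: real_vec_inj; rewrite (real_vec_mul_comb _ rH) -row_mul -eu ru.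
have etaG y : S *m real_comb (row y eta) G = S *m B y.
  by apply: real_vec_inj; rewrite (real_vec_mul_comb _ rG) -row_mul -ev rv.
have GB i Z : (forall x, A x *m Z = Z *m A x) -> G i *m Z = Z *m G i.
  exact: real_comb_comm.
have AH x i : A x *m H i = H i *m A x.
  by symmetry; apply: real_comb_comm => y; rewrite AB.
(* [S G G = S H G = S G H = S A H = S H A = S A A = S] for the combinations [G], [H]
   with coefficients [row x xi]. *)
have quadu x : S *m real_comb (row x xi) G *m real_comb (row x xi) G = S.
  have AHx x' : real_comb (row x xi) H *m A x' = A x' *m real_comb (row x xi) H.
    by apply: real_comb_comm => i; rewrite AH.
  have GHx : real_comb (row x xi) G *m real_comb (row x xi) H =
             real_comb (row x xi) H *m real_comb (row x xi) G.
    by apply: real_comb_comm => i; apply: GB => x'; rewrite AHx.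
  by rewrite xiG -xiH -mulmxA -GHx mulmxA xiG -mulmxA -AHx mulmxA xiH SAA.
(* Here [S G G = S B G = S G B = S B B = S], with [G] the combination of coefficients [row y eta]
   and [B] for [B y]. *)
have quadv y : S *m real_comb (row y eta) G *m real_comb (row y eta) G = S.
  have GBy : real_comb (row y eta) G *m B y = B y *m real_comb (row y eta) G.
    by apply: real_comb_comm => i; apply: GB => x; rewrite AB.
  by rewrite etaG -mulmxA -GBy mulmxA etaG SBB.
have rel i j := clifford_relations i j ext u1 v1 OO eu ev eOu eOv quadu quadv.
(* Generators are used in pairs; when the rank is odd, one is dropped. *)
set k := (\rank (u *m v^T))./2.
have kr : (k.*2 <= \rank u)%N.
  apply: leq_trans (mxrankM_maxl u v^T); rewrite /k -[X in (_ <= X)%N]odd_double_half.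
  exact: leq_addl.
have im2 : 'i%C * 'i%C = -1 :> C by rewrite -expr2 sqr_i.
have two0 : 2 != 0 :> C by rewrite pnatr_eq0.
have S0 : S != 0.
  by apply: contra_eq_neq S1 => ->; rewrite mul0mx mxtrace0 /= eq_sym oner_eq0.
(* Families on [nat], extended by zero from [\rank u] on; zero still commutes with everything. *)
pose ext0 (F : 'I_(\rank u) -> 'M[C]_N) i := oapp F 0 (insub i).
have ltE F i (hi : (i < k.*2)%N) : ext0 F i = F (Ordinal (leq_trans hi kr)).
  by rewrite /ext0 (insubT (fun l => (l < \rank u)%N) (leq_trans hi kr)).
apply: (clifford_vector_dim (A := A) (S := S) (G := ext0 G) (H := ext0 H) im2 two0 S0).
- move=> i Z hZ; rewrite /ext0; case: insubP => [j _ _|_] /=; first exact: GB.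
  by rewrite mul0mx mulmx0.
- by move=> i x hi; rewrite ltE AH.
- by move=> i hi; rewrite !ltE SGH.
by move=> i j hi hj; rewrite !ltE rel.
Qed.

End DimensionBound.

(** * Gram-Lorentz property and dimension bound at extreme points *)

Unset Implicit Arguments.

Theorem theorem5p9 (R : realType) (n m : nat) (Cm : 'M[R]_(n, m)) :
  extreme_Cor Cm ->
  gram_lorentz_behavior (pC Cm) /\
  (forall d : nat, has_rep (pC Cm) d ->
     Num.sqrt (2 : R) ^+ (\rank Cm)./2 <= d%:R).
Proof.
move=> extC; have [d0 rep0] := inCor_has_rep (proj1 extC).
split=> [|d rep].
  by split; [exists d0 | apply: vec_corr_gram_lorentz; apply: has_rep_gram rep0].
have hd : (2 ^ (\rank Cm)./2 <= d * d)%N.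
  have [->|C0] := eqVneq Cm 0; last exact: extreme_rep_dim (extreme_mid_extreme extC) C0 rep.
  (* For [Cm = 0] only [0 < d] is needed: an empty matrix has trace 0 and is no density. *)
  case: d rep => [|d] [rho [_ [_ [[_ trho] _]]]]; last by rewrite mxrank0 muln_gt0.
  by have := oner_neq0 (R[i]); rewrite -trho [rho]flatmx0 mxtrace0 eqxx.
(* Both sides are nonnegative, and squaring them gives [hd]. *)
rewrite -(@ler_pXn2r _ 2) // ?nnegrE ?ler0n ?exprn_ge0 ?sqrtr_ge0 //.
by rewrite exprAC sqr_sqrtr ?ler0n // -!natrX ler_nat -mulnn.
Qed.
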